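(* Let $n\ge2$. A map $\Psi:\mathrm{Conv}_{(0)}(\mathbb{R}^n)\to\mathrm{Conv}_{(0)}(\mathbb{R}^n)$ is continuous, additive, monotone, as well as radially and $\mathrm{SO}(n)$-equivariant if and only if there exists a (necessarily unique) $\mathrm{SO}(n-1)$-invariant measure $\mu\in\mathcal{M}_c^+(\mathbb{R}^n)$ such that $$\Psi(f)[x]=\int_{\mathbb{R}^n}f(\|x\|\vartheta_x y)\,d\mu(y),\qquad x\in\mathbb{R}^n\setminus\{0\},$$ and $\Psi(f)[0]=\liminf_{\|x\|\to0}\Psi(f)[x]=f(0)\mu(\mathbb{R}^n)$, for every $f\in\mathrm{Conv}_{(0)}(\mathbb{R}^n)$. Moreover, $\Psi$ is dually translation-invariant if and only if $\int_{\mathbb{R}^n}y\,d\mu(y)=0$.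
   Context: $\mathrm{Conv}(\mathbb{R}^n)$ is the set of all lower semi-continuous convex functions $f:\mathbb{R}^n\to(-\infty,+\infty]$ that are not identically $+\infty$, and $\mathrm{Conv}_{(0)}(\mathbb{R}^n)$ is the subset of those $f$ that are finite on a neighborhood of $0$. These spaces carry the topology induced by epi-convergence: $f_j$ epi-converges to $f$ if for every $x$ (i) $f(x)\le\liminf_j f_j(x_j)$ for every sequence $x_j\to x$, and (ii) there is a sequence $x_j\to x$ with $f(x)=\lim_j f_j(x_j)$. Continuity of $\Psi$ refers to this topology. $\Psi(f)[x]$ denotes the value of $\Psi(f)$ at $x$. $\Psi$ is additive if $\Psi(g+h)=\Psi(g)+\Psi(h)$ for all $g,h$ in the domain; monotone if $f\le g$ pointwise implies $\Psi(f)\le\Psi(g)$ pointwise; radially equivariant if $\Psi(f)[tx]=\Psi(f(t\,\cdot))[x]$ for all $t>0$, $x\in\mathbb{R}^n$ and all $f$; $\mathrm{SO}(n)$-equivariant if $\Psi(\eta\cdot f)=\eta\cdot\Psi(f)$ for all $\eta\in\mathrm{SO}(n)$, where $(\eta\cdot f)(x)=f(\eta^{-1}x)$; dually translation-invariant if $\Psi(f+\ell)=\Psi(f)$ for every $f$ and every linear function $\ell:\mathbb{R}^n\to\mathbb{R}$. Fix a unit vector $\bar e\in\mathbb{S}^{n-1}$; $\mathrm{SO}(n-1)$ denotes the stabilizer of $\bar e$ in $\mathrm{SO}(n)$. For every $x\neq0$ choose $\vartheta_x\in\mathrm{SO}(n)$ with $\vartheta_x\bar e=x/\|x\|$ (this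 determines $\vartheta_x$ up to right multiplication by $\mathrm{SO}(n-1)$, so the integral above does not depend on the choice). $\mathcal{M}_c^+(\mathbb{R}^n)$ is the set of non-negative (finite) Borel measures on $\mathbb{R}^n$ with compact support. *)

(* Defs.v *)
(* R^n is the space 'cV[R]_n of column vectors. *)
From HB Require Import structures.
From mathcomp Require Import all_boot all_order all_algebra.
From mathcomp Require Import all_classical all_reals all_analysis.

Set Implicit Arguments.
Unset Strict Implicit.
Unset Printing Implicit Defensive.

Import Order.TTheory GRing.Theory Num.Theory.
Import numFieldNormedType.Exports.

Local Open Scope classical_set_scope.
Local Open Scope ring_scope.

(* The library's norm on matrices is the sup norm; it induces the same
   topology, but it is not SO(n)-invariant. *)
Definition enorm (R : realType) (n : nat) (x : 'cV[R]_n) : R :=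
  Num.sqrt (\sum_(i < n) x i 0 ^+ 2).

Definition SO (R : realType) (n : nat) : set 'M[R]_n :=
  [set eta | eta *m eta^T = 1%:M /\ \det eta = 1].

Definition SO_stab (R : realType) (n : nat) (e : 'cV[R]_n) : set 'M[R]_n :=
  [set eta | SO eta /\ eta *m e = e].

Definition econvex (R : realType) (n : nat) (f : 'cV[R]_n -> \bar R) : Prop :=
  forall (x y : 'cV[R]_n) (t : R), 0 <= t <= 1 ->
    (f (t *: x + (1 - t) *: y)%R <= t%:E * f x + (1 - t)%:E * f y)%E.

Definition is_Conv (R : realType) (n : nat) (f : 'cV[R]_n -> \bar R) : Prop :=
  [/\ forall x, f x != -oo%E, exists x, f x != +oo%E,
      lower_semicontinuous f & econvex f].

Definition is_Conv0 (R : realType) (n : nat) (f : 'cV[R]_n -> \bar R) : Prop :=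
  is_Conv f /\ \forall x \near (0 : 'cV[R]_n), f x \is a fin_num.

Record Conv0 (R : realType) (n : nat) := MkConv0 {
  Conv0_fun :> 'cV[R]_n -> \bar R ;
  Conv0P : is_Conv0 Conv0_fun }.

Lemma Conv0_eq (R : realType) (n : nat) (f g : Conv0 R n) :
  (forall x, f x = g x) -> f = g.
Proof.
case: f g => [f fP] [g gP] /= /funext fg; move: fP gP.
by rewrite fg => fP gP; congr MkConv0; exact: Prop_irrelevance.
Qed.

Definition epi_cvg (R : realType) (n : nat)
    (fs : nat -> 'cV[R]_n -> \bar R) (f : 'cV[R]_n -> \bar R) : Prop :=
  forall x : 'cV[R]_n,
    (forall xs : nat -> 'cV[R]_n, xs @ \oo --> x ->
       (f x <= limn_einf (fun j => fs j (xs j)))%E) /\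
    (exists2 xs : nat -> 'cV[R]_n, xs @ \oo --> x &
       (fun j => fs j (xs j)) @ \oo --> f x).

(* The topology induced by epi-convergence: a set is open when every sequence
   epi-converging to one of its points is eventually in it. *)
Definition epi_open (R : realType) (n : nat) : set_system (Conv0 R n) :=
  [set U | forall (fs : nat -> Conv0 R n) (f : Conv0 R n),
     U f -> epi_cvg fs f -> \forall j \near \oo, U (fs j)].

Section epi_topology.
Context {R : realType} {n : nat}.

Let epi_openT : epi_open (setT : set (Conv0 R n)).
Proof. by move=> fs f _ _; exact: nearW. Qed.

Let epi_openI : setI_closed (@epi_open R n).
Proof.
move=> A B oA oB fs f [Af Bf] fsf.
exact: filterI (oA fs f Af fsf) (oB fs f Bf fsf).
Qed.

Let epi_open_bigU (I : Type) (U : I -> set (Conv0 R n)) :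
  (forall i, epi_open (U i)) -> epi_open (\bigcup_i U i).
Proof.
move=> oU fs f [i _ Uif] fsf.
by apply: filterS (oU i fs f Uif fsf) => j Uj; exists i.
Qed.

HB.instance Definition _ := gen_eqMixin (Conv0 R n).
HB.instance Definition _ := gen_choiceMixin (Conv0 R n).
HB.instance Definition _ := isOpenTopological.Build (Conv0 R n)
  epi_openT epi_openI epi_open_bigU.

Lemma epi_openE : @open (Conv0 R n) = @epi_open R n.
Proof. by []. Qed.

End epi_topology.

Section Conv0_operations.
Context {R : realType} {n : nat}.
Implicit Types f g : 'cV[R]_n -> \bar R.

Lemma linear_form_continuous (l : {linear 'cV[R]_n -> R^o}) :
  continuous (l : 'cV[R]_n -> R).
Proof.
have -> : (l : 'cV[R]_n -> R) =
    (fun x => \sum_(i < n) x i 0 * l (delta_mx i 0)).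
  apply/funext => x; rewrite {1}[x]matrix_sum_delta linear_sum.
  by apply: eq_bigr => i _; rewrite big_ord1 linearZ.
apply: continuous_big => [|i _ x]; first exact: add_continuous.
by apply: cvgMr_tmp; [exact: (nbhs_filter x)|exact: coord_continuous].
Qed.

Lemma mulmx_continuous (A : 'M[R]_n) : continuous (fun x : 'cV[R]_n => A *m x).
Proof.
have -> : (fun x : 'cV[R]_n => A *m x) =
    (fun x => \sum_(i < n) x i 0 *: col i A).
  apply/funext => x; apply/matrixP => i j; rewrite ord1 mxE summxE.
  by apply: eq_bigr => k _; rewrite !mxE mulrC.
apply: continuous_big => [|i _ x]; first exact: add_continuous.
by apply: cvgZr_tmp; [exact: (nbhs_filter x)|exact: coord_continuous].
Qed.

Lemma is_Conv0_comp_mulmx (f : 'cV[R]_n -> \bar R) (A : 'M[R]_n) :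
  is_Conv0 f -> is_Conv0 (fun x => f (A *m x)).
Proof.
move=> [[fN [_ _] lf cf] f0].
have f0A : \forall x \near (0 : 'cV[R]_n), f (A *m x) \is a fin_num.
  by apply: (@mulmx_continuous A 0 [set y | f y \is a fin_num]); rewrite mulmx0.
split=> //; split=> //.
- by exists 0; move/nbhs_singleton: f0A; rewrite fin_numE => /andP[].
- move=> x a /lf [V VA Va]; exists ((fun x : 'cV[R]_n => A *m x) @^-1` V).
    exact: mulmx_continuous.
  by move=> y /Va.
- by move=> x y t t01; rewrite mulmxDr -!scalemxAr; exact: cf.
Qed.

Lemma is_Conv0_comp_scale (f : 'cV[R]_n -> \bar R) (t : R) :
  is_Conv0 f -> is_Conv0 (fun x => f (t *: x)).
Proof.
move=> /(is_Conv0_comp_mulmx t%:M); congr is_Conv0.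
by apply/funext => x; rewrite mul_scalar_mx.
Qed.

Lemma is_Conv0_add f g :
  is_Conv0 f -> is_Conv0 g -> is_Conv0 (fun x => f x + g x)%E.
Proof.
move=> [[fN _ lf cf] f0] [[gN _ lg cg] g0].
have fg0 : \forall x \near (0 : 'cV[R]_n), (f x + g x)%E \is a fin_num.
  by apply: filterS2 f0 g0 => x fx gx; rewrite fin_numD fx gx.
split=> //; split.
- by move=> x; rewrite adde_eq_ninfty negb_or fN gN.
- by exists 0; move/nbhs_singleton: fg0; rewrite fin_numE => /andP[].
- move=> x a afg.
  have [[b c] /= [bf cg' abc]] : exists bc : R * R,
      [/\ (bc.1%:E < f x)%E, (bc.2%:E < g x)%E & a <= bc.1 + bc.2].
    have := fN x; have := gN x; move: afg.
    case: (f x) => [r| |] //; case: (g x) => [s| |] //=.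
    + rewrite -EFinD lte_fin => ars _ _.
      exists (r - (r + s - a) / 2, s - (r + s - a) / 2); split => /=.
      * by rewrite lte_fin ltrBlDr ltrDl divr_gt0// subr_gt0.
      * by rewrite lte_fin ltrBlDr ltrDl divr_gt0// subr_gt0.
      * by rewrite addrACA -opprD -splitr subKr.
    + move=> _ _ _; exists (r - 1, a - (r - 1)); split => /=.
      * by rewrite lte_fin ltrBlDr ltrDl.
      * by rewrite ltry.
      * by rewrite addrC subrK.
    + move=> _ _ _; exists (a - (s - 1), s - 1); split => /=.
      * by rewrite ltry.
      * by rewrite lte_fin ltrBlDr ltrDl.
      * by rewrite subrK.
    + by move=> _ _ _; exists (a, 0); split; rewrite /= ?ltry ?addr0.
  have [V Vx Vb] := lf _ _ bf; have [W Wx Wc] := lg _ _ cg'.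
  exists (V `&` W); first exact: filterI.
  move=> y [/Vb fy /Wc gy]; apply: (@le_lt_trans _ _ (b%:E + c%:E)%E).
    by rewrite -EFinD lee_fin.
  exact: lteD.
- move=> x y t t01; apply: (le_trans (leeD (cf x y t t01) (cg x y t t01))).
  have fgD u : (f u +? g u)%E by apply: ltninfty_adde_def; rewrite inE ltNye.
  by rewrite !muleDr// addeACA.
Qed.

Lemma is_Conv0_linear (l : {linear 'cV[R]_n -> R^o}) :
  is_Conv0 (fun x => (l x : R)%:E).
Proof.
split; last by apply: filterE => x; rewrite fin_numE.
split=> //; first by exists 0.
- move=> x a; rewrite lte_fin => ax.
  exists [set y | a < l y] => //.
  by apply: (@linear_form_continuous l x [set z | a < z]); exact: lt_nbhsr.
- by move=> x y t _; rewrite linearD !linearZ.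
Qed.

Definition Conv0_add (f g : Conv0 R n) : Conv0 R n :=
  MkConv0 (is_Conv0_add (Conv0P f) (Conv0P g)).

Definition Conv0_add_linear (f : Conv0 R n) (l : {linear 'cV[R]_n -> R^o}) :
  Conv0 R n := Conv0_add f (MkConv0 (is_Conv0_linear l)).

Definition Conv0_dilate (t : R) (f : Conv0 R n) : Conv0 R n :=
  MkConv0 (is_Conv0_comp_scale t (Conv0P f)).

Definition Conv0_act (eta : 'M[R]_n) (f : Conv0 R n) : Conv0 R n :=
  MkConv0 (is_Conv0_comp_mulmx (invmx eta) (Conv0P f)).

End Conv0_operations.

Section maps.
Context {R : realType} {n : nat}.
Implicit Type Psi : Conv0 R n -> Conv0 R n.

Definition Conv0_additive Psi : Prop :=
  forall g h, Psi (Conv0_add g h) = Conv0_add (Psi g) (Psi h).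

Definition Conv0_monotone Psi : Prop :=
  forall f g : Conv0 R n, (forall x, (f x <= g x)%E) ->
    forall x, (Psi f x <= Psi g x)%E.

Definition radially_equivariant Psi : Prop :=
  forall (t : R) (x : 'cV[R]_n) (f : Conv0 R n), 0 < t ->
    Psi f (t *: x) = Psi (Conv0_dilate t f) x.

Definition SO_equivariant Psi : Prop :=
  forall (eta : 'M[R]_n) (f : Conv0 R n), SO eta ->
    Psi (Conv0_act eta f) = Conv0_act eta (Psi f).

Definition dually_translation_invariant Psi : Prop :=
  forall (f : Conv0 R n) (l : {linear 'cV[R]_n -> R^o}),
    Psi (Conv0_add_linear f l) = Psi f.

End maps.

Definition borelRn (R : realType) (n : nat) :=
  g_sigma_algebraType (@open 'cV[R]_n).

Section borel_measures.
Context {R : realType} {n : nat}.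
Implicit Type mu : {finite_measure set (borelRn R n) -> \bar R}.

Definition measure_support mu : set 'cV[R]_n :=
  [set x | forall U : set 'cV[R]_n, open_nbhs x U -> (0 < mu U)%E].

Definition compactly_supported mu : Prop := compact (measure_support mu).

Definition SO_stab_invariant (e : 'cV[R]_n) mu : Prop :=
  forall eta : 'M[R]_n, SO_stab e eta ->
    forall A : set (borelRn R n), measurable A ->
      mu ((fun y : 'cV[R]_n => eta *m y) @^-1` A) = mu A.

Definition first_moment mu : 'cV[R]_n :=
  \col_(i < n) (\int[mu]_y ((y : 'cV[R]_n) i 0))%R.

(* theta x stands for the chosen rotation taking e to x / |x|, hence is only
   used for x != 0; the liminf at 0 is over the punctured neighborhoods. *)
Definition represents (theta : 'cV[R]_n -> 'M[R]_n)
    (Psi : Conv0 R n -> Conv0 R n) mu : Prop :=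
  forall f : Conv0 R n,
    [/\ forall x : 'cV[R]_n, x != 0 ->
          Psi f x =
            (\int[mu]_y f (enorm x *: (theta x *m (y : 'cV[R]_n)))%R)%E,
        Psi f 0 = limf_einf (Psi f) (0 : 'cV[R]_n)^' &
        limf_einf (Psi f) (0 : 'cV[R]_n)^' = (f 0%R * mu setT)%E].

End borel_measures.

(* Main.v *)
Require Import Defs.
From HB Require Import structures.
From mathcomp Require Import all_boot all_order all_algebra.
From mathcomp Require Import all_classical all_reals all_analysis.
From mathcomp Require Import measurable_realfun.
From mathcomp Require Import ring lra.

Set Implicit Arguments.
Unset Strict Implicit.
Unset Printing Implicit Defensive.

Import Order.TTheory GRing.Theory Num.Theory.
Import numFieldNormedType.Exports.

Local Open Scope classical_set_scope.
Local Open Scope ring_scope.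

(** From a map to a measure. By the two equivariance properties, [Psi] is
    determined by the functional [F f = Psi f e]. The indicator [I] of a ball
    satisfies [I + I = I], so [F I] is 0 or +oo; as [Psi I] is finite near 0,
    radial equivariance makes [F I = 0] for a large ball [B]
    ([ball_pole_value0]). Adding [I] thus changes no value of [F], whence
    [F f <= F g] as soon as [f <= g] on [B] ([pole_value_le]): the functional
    is finite on finite convex functions and only sees the ball.

    Differences of continuous convex functions form a vector lattice, to which
    [F] extends as a positive additive functional. The lattice contains the
    squared Euclidean distance to every closed set ([open_dc_distance]), hence
    bump functions increasing to the indicator of any open set. The Riesz
    construction, with the Caratheodory extension of the outer measure obtained
    from the masses of open sets, then represents [F] on finite convex functions
    by a measure carried by [B] ([convex_riesz_representation]); the same bumps
    show that a compactly supported measure is determined by the integrals of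
    these functions ([cconvex_measure_unique]), which yields its uniqueness and
    its invariance under the stabilizer of [e]. A general function is the
    increasing limit of its inf-convolutions with multiples of the norm
    ([is_Conv0_approximation]). Continuity of [Psi] makes [f |-> Psi f e] lower
    semicontinuous along this sequence, so that the representation passes to the
    limit ([pole_value_integral]).

    From a measure to a map. Everything but continuity follows from the
    properties of the integral, two rotations with the same pole differing by an
    element of the stabilizer ([integral_same_pole]). For continuity, let [f_j]
    epi-converge to [f]. Convexity bounds the [f_j] uniformly near 0 from above
    ([epi_cvg_bounded_near0]) and on bounded sets from below. Fatou's lemma
    controls the lower limit of [Psi f_j x] for fixed [x]; applied to opposite
    functions at the contracted points [t *: x], where the [f_j] are also bounded
    above on the support, it controls the upper limit ([epi_integral_upper]).
    Convexity along segments from 0 turns these pointwise bounds into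
    epi-convergence ([epi_cvg_criterion]).

    The effect of adding a linear function [l] to [f] is to add [l] evaluated at
    a rotated multiple of the first moment ([represents_add_linear]), which gives
    the characterization of dual translation-invariance. *)

(** * Extended real sequences *)

Section ereal_sequences.
Context {R : realType}.
Implicit Types (x y l : \bar R) (u : nat -> \bar R).
Local Open Scope ereal_scope.

Lemma le_ereal_fin_lt x y : (forall a : R, a%:E < x -> a%:E <= y) -> x <= y.
Proof.
case: x => [r| |] H; last exact: leNye.
- apply/lee_subgt0Pr => e e0; rewrite -EFinB; apply: H.
  by rewrite lte_fin ltrBlDr ltrDl.
- by rewrite leye_eq; apply/eqP/eqyP => A _; apply: H; rewrite ltry.
Qed.

Lemma lte_fin_between x (r : R) : x < r%:E -> exists2 b : R, x <= b%:E & (b < r)%R.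
Proof.
case: x => [s| |] // sr; first by exists s.
by exists (r - 1)%R; [exact: leNye|rewrite ltrBlDr ltrDl].
Qed.

Lemma lt_fin_between (a : R) x : a%:E < x -> exists2 b : R, (a < b)%R & b%:E < x.
Proof.
case: x => [r| |] //; last by exists (a + 1)%R; rewrite ?ltrDl ?ltry.
by rewrite lte_fin => ar; exists ((a + r) / 2)%R; rewrite ?lte_fin ?midf_lt.
Qed.

Lemma limn_einf_ge u l :
  (forall a : R, a%:E < l -> \forall j \near \oo, a%:E <= u j) ->
  l <= limn_einf u.
Proof.
move=> H; apply: le_ereal_fin_lt => a /H [N _ Na].
rewrite /limn_einf -/(limf_einf u \oo) limf_einfE.
apply: le_trans (ereal_sup_ubound _); last first.
  by exists [set k | (N <= k)%N] => //; exists N.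
by apply: le_ereal_inf_tmp => _ [k /= Nk <-]; exact: Na.
Qed.

Lemma limn_einf_gt u l (a : R) :
  l <= limn_einf u -> a%:E < l -> \forall j \near \oo, a%:E < u j.
Proof.
move=> lu al; have := lt_le_trans al lu.
rewrite /limn_einf -/(limf_einf u \oo) limf_einfE.
move=> /ereal_sup_gt[_ [A A_oo <-]] aA.
apply: filterS A_oo => j Aj; apply: lt_le_trans aA _.
by apply: ereal_inf_lbound; exists j.
Qed.

Lemma cvge_of_bounds u l :
  (forall a : R, a%:E < l -> \forall j \near \oo, a%:E <= u j) ->
  (forall b : R, l < b%:E -> \forall j \near \oo, u j <= b%:E) ->
  u @ \oo --> l.
Proof.
move=> Hl Hu.
have lu : l <= limn_einf u by exact: limn_einf_ge.
have ul : limn_esup u <= l.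
  rewrite -leeN2; apply: le_ereal_fin_lt => a al.
  have /Hu[N _ Na] : l < (- a)%:E by rewrite EFinN lteNr.
  rewrite leeNr -EFinN /limn_esup limf_esupE.
  apply: le_trans (ereal_inf_lbound _) _.
    by exists [set k | (N <= k)%N]; [exists N|reflexivity].
  by apply: ge_ereal_sup => _ [k /= Nk <-]; exact: Na.
have e1 : limn_einf u = l.
  by apply/eqP; rewrite eq_le lu andbT (le_trans (limn_einf_sup _)).
have e2 : limn_esup u = l.
  by apply/eqP; rewrite eq_le ul/= (le_trans lu)// limn_einf_sup.
move: e1 e2; rewrite limn_einf_lim limn_esup_lim => e1 e2.
apply: (@squeeze_cvge _ _ _ _ (einfs u) _ (esups u)).
- by apply: nearW => n; apply/andP; split;
    [apply: ereal_inf_lbound; exists n => /=|apply: ereal_sup_ubound; exists n => /=].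
- by rewrite -e1; exact: is_cvg_einfs.
- by rewrite -e2; exact: is_cvg_esups.
Qed.

End ereal_sequences.

(** * Convex functions *)

Section convex_bounds.
Context {R : realType} {n : nat}.
Notation V := 'cV[R]_n.
Implicit Types (f : V -> \bar R) (x y z : V).

Lemma econvex_le f x y (t a b : R) : econvex f -> 0 <= t <= 1 ->
  (f x <= a%:E)%E -> (f y <= b%:E)%E ->
  (f (t *: x + (1 - t) *: y)%R <= (t * a + (1 - t) * b)%:E)%E.
Proof.
move=> cf t01 fa fb; apply: le_trans (cf x y t t01) _.
rewrite [leRHS]EFinD !EFinM; case/andP: t01 => t0 t1.
by apply: leeD; [apply: lee_wpmul2l|apply: lee_wpmul2l]; rewrite ?lee_fin ?subr_ge0.
Qed.

(** The center [z] is a convex combination of [x] and of the point of the ball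
    opposite to [x], where [f] is at most [M]; this prevents [f x] from being
    small. *)
Lemma econvex_lower_bound f z (d M c : R) : econvex f -> 0 < d ->
  (forall w, `|w - z| <= d -> (f w <= M%:E)%E) -> (c%:E <= f z)%E ->
  forall x, ((c - `|x - z| / d * (M - c))%:E <= f x)%E.
Proof.
move=> cf d0 fM cfz x; rewrite leNgt; apply/negP => /lte_fin_between[b fxb].
have [xz|] := eqVneq x z.
  rewrite xz subrr normr0 mul0r mul0r subr0 => bc.
  by rewrite xz in fxb; have := le_trans cfz fxb; rewrite lee_fin leNgt bc.
rewrite -subr_eq0 -normr_gt0 => N0; set N := `|x - z| in N0 *.
pose y := z - (d / N) *: (x - z); pose t := d / (d + N).
have dN : 0 < d + N by rewrite addr_gt0.
have fy : (f y <= M%:E)%E.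
  apply: fM; rewrite /y addrC addKr normrN normrZ -/N ger0_norm ?divr_ge0 ?(ltW d0) ?(ltW N0)//.
  by rewrite divfK// gt_eqF.
have t01 : 0 <= t <= 1.
  by rewrite divr_ge0 ?(ltW d0) ?(ltW dN)//= ler_pdivrMr// mul1r lerDl ltW.
have ez : t *: x + (1 - t) *: y = z.
  apply/matrixP => i j; rewrite !mxE /t; field.
  by rewrite !gt_eqF.
have := econvex_le cf t01 fxb fy; rewrite ez => /(le_trans cfz).
rewrite lee_fin => ctb bc.
have : c * (d + N) <= d * b + N * M.
  rewrite -ler_pdivlMr//; apply: le_trans ctb _.
  by rewrite le_eqVlt; apply/orP; left; apply/eqP; rewrite /t; field; rewrite gt_eqF.
move=> h; move: bc; rewrite ltNge => /negP; apply.
rewrite -(ler_pM2l d0).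
rewrite (_ : d * (c - N / d * (M - c)) = c * (d + N) - N * M).
  by rewrite lerBlDr.
by field; rewrite gt_eqF.
Qed.

Lemma econvex_upper_bound f z (d M c : R) : econvex f -> 0 < d ->
  (forall w, `|w - z| <= d -> (f w <= M%:E)%E) -> (f z <= c%:E)%E ->
  forall x, `|x - z| <= d -> (f x <= (c + `|x - z| / d * (M - c))%:E)%E.
Proof.
move=> cf d0 fM fzc x xd.
have [->|] := eqVneq x z.
  by rewrite subrr normr0 mul0r mul0r addr0.
rewrite -subr_eq0 -normr_gt0 => N0; set N := `|x - z| in N0 xd *.
pose y := z + (d / N) *: (x - z).
have fy : (f y <= M%:E)%E.
  apply: fM; rewrite /y addrC addKr normrZ -/N ger0_norm ?divr_ge0 ?(ltW d0) ?(ltW N0)//.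
  by rewrite divfK// gt_eqF.
have t01 : 0 <= N / d <= 1.
  by rewrite divr_ge0 ?(ltW d0) ?(ltW N0)//= ler_pdivrMr// mul1r.
have ex : (N / d) *: y + (1 - N / d) *: z = x.
  by apply/matrixP => i j; rewrite !mxE; field; rewrite !gt_eqF.
have := econvex_le cf t01 fy fzc; rewrite ex => /le_trans; apply.
by rewrite lee_fin le_eqVlt; apply/orP; left; apply/eqP; ring.
Qed.

End convex_bounds.

(** * Epi-convergence of convex functions *)

Section epi_convergence.
Context {R : realType} {n : nat}.
Notation V := 'cV[R]_n.
Implicit Types (f h : V -> \bar R) (fs hs : nat -> V -> \bar R) (x y z : V).

Lemma mx_norm_le p q (u : 'M[R]_(p, q)) (r : R) : 0 <= r ->
  (forall i j, `|u i j| <= r) -> `|u| <= r.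
Proof.
move=> r0 ur; rewrite (_ : `|u| = mx_norm u)// mx_normrE.
by apply/bigmax_leP; split => // -[i j] _; exact: ur.
Qed.

Lemma mx_coord_le_norm p q (u : 'M[R]_(p, q)) i j : `|u i j| <= `|u|.
Proof.
rewrite (_ : `|u| = mx_norm u)// mx_normrE.
by apply/bigmax_geP; right; exists (i, j).
Qed.

Lemma norm_trmx_le p q (u : 'M[R]_(p, q)) : `|u^T| <= `|u|.
Proof. by apply: mx_norm_le => // i j; rewrite mxE mx_coord_le_norm. Qed.

Lemma cV_closed_ball_closed (r : R) : closed [set x : V | `|x| <= r].
Proof.
exact: (closed_comp (fun u _ => @norm_continuous _ _ u) (@closed_le _ r)).
Qed.

Lemma cV_closed_ball_compact (r : R) : compact [set x : V | `|x| <= r].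
Proof.
have -> : [set x : V | `|x| <= r] =
    (fun u : 'rV[R]_n => u^T) @` [set u : 'rV[R]_n | `|u| <= r].
  apply/seteqP; split => [x /= xr|_ [u /= ur <-]]/=.
    by exists x^T; rewrite ?trmxK//= (le_trans (norm_trmx_le _)).
  exact: le_trans (norm_trmx_le _) ur.
apply: continuous_compact.
  apply: continuous_subspaceT => u.
  apply/(@cvgrPdist_le _ _ _ (nbhs u) (nbhs_filter u)) => e e0.
  apply: filterS (@cvgr_dist_le _ _ _ (nbhs u) (nbhs_filter u) id u cvg_id e e0).
  by move=> w /= uw; rewrite -linearB/= (le_trans (norm_trmx_le _)).
apply: bounded_closed_compact.
  exists r; split; first exact: num_real.
  by move=> M rM u /= /le_trans; apply; exact: ltW.
exact: (closed_comp (fun u _ => @norm_continuous _ _ u) (@closed_le _ r)).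
Qed.

Lemma epi_cvg_liminf fs f (xs : nat -> V) x (a : R) : epi_cvg fs f ->
  xs @ \oo --> x -> (a%:E < f x)%E -> \forall j \near \oo, (a%:E < fs j (xs j))%E.
Proof. by move=> /(_ x)[/(_ xs) + _] xsx => /(_ xsx); exact: limn_einf_gt. Qed.

(** Dyadic averaging turns an approximation of the points of a ball up to half
    its radius into arbitrarily good approximations of the points of the
    half-size ball. *)
Lemma dyadic_approximation (Q : set V) (d : R) : 0 < d ->
  (forall x y, Q x -> Q y -> Q (2^-1 *: x + 2^-1 *: y)) ->
  (forall b, `|b| <= d -> exists2 q, Q q & `|b - q| <= d / 2) ->
  forall m b, `|b| <= d ->
    exists2 q, Q q & `|2^-1 *: b - q| <= d * 2^-1 ^+ m.
Proof.
move=> d0 Qmid Qd; elim=> [|m IH] b bd; have [q Qq qb] := Qd b bd.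
  exists q => //; rewrite expr0 mulr1.
  have -> : 2^-1 *: b - q = (b - q) + (- 2^-1) *: b.
    by apply/matrixP => i j; rewrite !mxE; field.
  apply: le_trans (ler_normD _ _) _; rewrite normrZ normrN ger0_norm ?invr_ge0//.
  by rewrite [leRHS](splitr d) lerD// mulrC ler_pM2r.
have [|q' Qq' q'b] := IH (2 *: (b - q)).
  by rewrite normrZ ger0_norm// mulrC -ler_pdivlMr.
exists (2^-1 *: q + 2^-1 *: q'); first exact: Qmid.
have -> : 2^-1 *: b - (2^-1 *: q + 2^-1 *: q') =
    2^-1 *: (2^-1 *: (2 *: (b - q)) - q').
  by apply/matrixP => i j; rewrite !mxE; field.
rewrite normrZ ger0_norm ?invr_ge0// exprS mulrCA.
by rewrite ler_pM2l// invr_gt0.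
Qed.

(** Recovery sequences at finitely many points of a ball bound the functions on
    a half-radius net of that ball, and convexity fills the ball of half
    size. *)
Lemma epi_cvg_bounded_near0 fs f : epi_cvg fs f ->
  (forall j, is_Conv0 (fs j)) -> is_Conv0 f ->
  exists d M : R, 0 < d /\
    \forall j \near \oo, forall w, `|w| <= d -> (fs j w <= M%:E)%E.
Proof.
move=> fsf fsC [_ /nbhs_normP[d0 /= d00 fd0]].
have lf j : lower_semicontinuous (fs j) by have [[]] := fsC j.
have cf j : econvex (fs j) by have [[]] := fsC j.
pose d := d0 / 2; have d_gt0 : 0 < d by rewrite divr_gt0.
have net : \forall Mj \near (pinfty_nbhs R, \oo),
    forall b, `|b| <= d -> exists2 q, (fs Mj.2 q <= Mj.1%:E)%E & `|b - q| <= d / 2.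
  have /compact_near_coveringP := @cV_closed_ball_compact d.
  move=> /(_ _ (filter_prod (pinfty_nbhs R) \oo)
    (fun Mj b => exists2 q, (fs Mj.2 q <= Mj.1%:E)%E & `|b - q| <= d / 2)).
  apply => b /= bd.
  have fb : f b \is a fin_num.
    apply: fd0; rewrite /= sub0r normrN; apply: le_lt_trans bd _.
    by rewrite ltr_pdivrMr// ltr_pMr// ltr1n.
  have [xs xsb fsb] := (fsf b).2.
  pose M := fine (f b) + 1.
  have d40 : 0 < d / 4 by rewrite divr_gt0.
  have fbM : (f b < M%:E)%E by rewrite -(fineK fb) lte_fin ltrDl.
  have n1 : \forall j \near \oo, (fs j (xs j) < M%:E)%E.
    exact: (fsb _ (open_ereal_lt' fbM)).
  have n2 : \forall j \near \oo, `|b - xs j| <= d / 4.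
    exact: cvgr_dist_le _ _ xsb _ d40.
  have n3 : nbhs b [set b' | `|b - b'| <= d / 4].
    exact: (@cvgr_dist_le _ _ _ (nbhs b) (nbhs_filter b) id b cvg_id _ d40).
  exists ([set b' | `|b - b'| <= d / 4],
    [set Mj | M <= Mj.1 /\ ((fs Mj.2 (xs Mj.2) < M%:E)%E /\ `|b - xs Mj.2| <= d / 4)]).
    split => //=.
    exists ([set M' | M <= M'],
      [set j | (fs j (xs j) < M%:E)%E /\ `|b - xs j| <= d / 4]).
      by split => /=; [apply: nbhs_pinfty_ge; exact: num_real|exact: filterS2 n1 n2].
    by move=> [M' j] [].
  move=> [b' [M' j]] [/= bb' [MM' [fM xb]]]; exists (xs j).
    by apply: le_trans (ltW fM) _; rewrite lee_fin.
  have -> : b' - xs j = (b - xs j) - (b - b') by apply/matrixP => i k; rewrite !mxE; ring.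
  apply: le_trans (ler_normB _ _) _; apply: le_trans (lerD xb bb') _.
  by rewrite le_eqVlt; apply/orP; left; apply/eqP; field.
case: net => -[/= A B] [Aoo Boo] AB.
have [M AM] := filter_ex Aoo.
exists (d / 2), M; split; first by rewrite divr_gt0.
apply: filterS Boo => j Bj w wd.
have /= Qd := AB (M, j) (conj AM Bj).
have Qmid x y : (fs j x <= M%:E)%E -> (fs j y <= M%:E)%E ->
    (fs j (2^-1 *: x + 2^-1 *: y)%R <= M%:E)%E.
  move=> fx fy; have h01 : 0 <= (2^-1 : R) <= 1 by lra.
  have := econvex_le (cf j) h01 fx fy.
  rewrite (_ : 1 - 2^-1 = 2^-1 :> R); last by field.
  by rewrite (_ : 2^-1 * M + 2^-1 * M = M); last by field.
rewrite leNgt; apply/negP => /(lf j)[U /nbhs_normP[e /= e0 eU] UM].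
have [m dm] : exists m, d * 2^-1 ^+ m < e.
  have : (d * 2^-1 ^+ m) @[m --> \oo] --> 0.
    rewrite -[X in _ --> X](mulr0 d); apply: cvgMl_tmp.
    by apply: cvg_expr; rewrite ger0_norm ?invr_ge0// invf_lt1// ltr1n.
  by move=> /cvgr_lt/(_ _ e0)[m _ /(_ m (leqnn m))]; exists m.
have [|q Qq qw] := @dyadic_approximation [set q | (fs j q <= M%:E)%E] d d_gt0
    Qmid Qd m (2 *: w).
  by rewrite normrZ ger0_norm// mulrC -ler_pdivlMr.
have /UM : U q.
  apply: eU; rewrite /=; apply: le_lt_trans dm.
  by rewrite scalerA mulVf// scale1r in qw.
by rewrite ltNge Qq.
Qed.

End epi_convergence.

Section epi_criterion.
Context {R : realType} {n : nat}.
Notation V := 'cV[R]_n.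
Implicit Types (f h : V -> \bar R) (fs hs : nat -> V -> \bar R) (x y z : V).

Lemma epi_cvg_cst f : lower_semicontinuous f -> epi_cvg (fun=> f) f.
Proof.
move=> lf x; split=> [xs xsx|]; last by exists (fun=> x); exact: cvg_cst.
apply: limn_einf_ge => a /lf[U Ux Ua].
have Uj : \forall j \near \oo, U (xs j) := xsx U Ux.
by apply: filterS Uj => j /Ua /ltW.
Qed.

Lemma is_Conv0_bounded_near0 f : is_Conv0 f ->
  exists d M : R, 0 < d /\ forall w, `|w| <= d -> (f w <= M%:E)%E.
Proof.
move=> fC; have lf : lower_semicontinuous f by case: fC => -[].
have [d [M [d0 [N _ NM]]]] := epi_cvg_bounded_near0 (epi_cvg_cst lf) (fun=> fC) fC.
by exists d, M; split => //; exact: (NM N (leqnn N)).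
Qed.

Lemma is_Conv0_fin0 f : is_Conv0 f -> f 0 \is a fin_num.
Proof. by move=> [_ /nbhs_singleton]. Qed.

(** The lower half holds on the whole space, by convexity along the lines
    through 0; it serves as a substitute for an affine minorant. *)
Lemma is_Conv0_lipschitz_at0 f : is_Conv0 f ->
  exists d C : R, [/\ 0 < d, 0 <= C,
    forall x, ((fine (f 0) - C * `|x|)%:E <= f x)%E &
    forall x, `|x| <= d -> (f x <= (fine (f 0) + C * `|x|)%:E)%E].
Proof.
move=> f0; have [d [M [d0 fM]]] := is_Conv0_bounded_near0 f0.
have f0E := fineK (is_Conv0_fin0 f0); set c := fine (f 0) in f0E *.
have cM : c <= M by rewrite -lee_fin f0E fM// normr0 ltW.
have fM0 w : `|w - 0| <= d -> (f w <= M%:E)%E by rewrite subr0; exact: fM.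
have cf : econvex f by case: f0 => -[].
exists d, ((M - c) / d); split => //.
- by rewrite divr_ge0 ?subr_ge0// ltW.
- move=> x; have := @econvex_lower_bound _ _ f 0 d M c cf d0 fM0.
  rewrite f0E lexx => /(_ isT x); rewrite subr0.
  by rewrite (_ : _ / d * (M - c) = (M - c) / d * `|x|)//; ring.
- move=> x xd; have := @econvex_upper_bound _ _ f 0 d M c cf d0 fM0.
  rewrite f0E lexx => /(_ isT x); rewrite subr0 => /(_ xd).
  by rewrite (_ : _ / d * (M - c) = (M - c) / d * `|x|)//; ring.
Qed.

Lemma is_Conv0_limf_einf0 f (e : V) : e != 0 -> is_Conv0 f ->
  limf_einf f (0 : V)^' = f 0.
Proof.
move=> e0 f0; have [d [C [d0 C0 _ fC]]] := is_Conv0_lipschitz_at0 f0.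
have f0E := fineK (is_Conv0_fin0 f0).
have lf : lower_semicontinuous f by case: f0 => -[].
rewrite limf_einfE; apply/eqP; rewrite eq_le; apply/andP; split; last first.
  apply: le_ereal_fin_lt => a /lf[U U0 Ua].
  apply: le_trans (ereal_sup_ubound _); last first.
    by exists U => //; exact: nbhs_dnbhs.
  by apply: le_ereal_inf_tmp => _ [x /= Ux <-]; exact/ltW/Ua.
apply: ge_ereal_sup => _ [A /nbhs_normP[r /= r0 rA] <-].
rewrite -f0E; apply/lee_addgt0Pr => eps eps0.
have ne : 0 < `|e| by rewrite normr_gt0.
pose s := Num.min (r / 2) (Num.min d (eps / (C + 1))) / `|e|.
have C1 : 0 < C + 1 by rewrite ltr_wpDl.
have s0 : 0 < s by rewrite divr_gt0// !lt_min !divr_gt0// d0.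
have sE : `|s *: e| = Num.min (r / 2) (Num.min d (eps / (C + 1))).
  by rewrite normrZ gtr0_norm// divfK// gt_eqF.
have sr : `|s *: e| < r.
  by rewrite sE gt_min ltr_pdivrMr// ltr_pMr// ltr1n.
have sd : `|s *: e| <= d by rewrite sE !ge_min lexx orbT.
have se : `|s *: e| <= eps / (C + 1) by rewrite sE !ge_min lexx !orbT.
apply: le_trans (ereal_inf_lbound _) _.
  exists (s *: e); last by [].
  apply: rA; first by rewrite /= sub0r normrN.
  by rewrite scaler_eq0 negb_or gt_eqF.
apply: le_trans (fC _ sd) _; rewrite -EFinD lee_fin lerD2l.
apply: le_trans (ler_wpM2l C0 se) _.
by rewrite mulrA ler_pdivrMr// mulrC ler_pM2l// lerDl.
Qed.

(** [c j] is the largest [m <= j] for which [P m] holds from [j] on. *)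
Lemma diagonal_sequence (P : nat -> nat -> Prop) :
  (forall m, \forall j \near \oo, P m j) ->
  exists2 c : nat -> nat, c @ \oo --> \oo & \forall j \near \oo, P (c j) j.
Proof.
move=> Poo.
pose Q j m := `[< forall i, (j <= i)%N -> P m i >].
exists (fun j => \max_(m < j.+1 | Q j m) m)%N.
  apply/cvgnyPge => m; have [N _ NP] := Poo m.
  exists (maxn m N) => // j /=; rewrite geq_max => /andP[mj Nj].
  apply: (@leq_bigmax_cond _ (fun i : 'I_j.+1 => Q j i) (@nat_of_ord _)
    (Ordinal (mj : (m < j.+1)%N))).
  by apply/asboolP => i ji; apply: NP; exact: leq_trans ji.
have [N _ NP] := Poo 0%N; exists N => // j /= Nj.
have : (0 < #|[pred m : 'I_j.+1 | Q j m]|)%N.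
  apply/card_gt0P; exists ord0; rewrite inE => i ji.
  by apply: NP; exact: leq_trans ji.
move=> /(eq_bigmax_cond (@nat_of_ord _))[m]; rewrite inE => Qm.
by rewrite (eq_bigl (fun m : 'I_j.+1 => Q j m))// => ->; exact: Qm.
Qed.

Lemma contraction_near x (U : set V) (a b M : R) : nbhs x U -> a < b ->
  exists t, [/\ 0 < t < 1, U (t *: x) & t * a + (1 - t) * M < b].
Proof.
move=> Ux ab.
have c1 : (t *: x) @[t --> (1 : R)^'-] --> x.
  rewrite -[X in _ --> X]scale1r; apply: cvg_at_left_filter.
  by apply: cvgZr_tmp; exact: cvg_id.
have c2 : (t * a + (1 - t) * M) @[t --> (1 : R)^'-] --> a.
  rewrite -[X in _ --> X]addr0 -{2}[a]mul1r -(mul0r M) -(subrr 1).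
  apply: cvg_at_left_filter; apply: cvgD; apply: cvgMr_tmp; first exact: cvg_id.
  by apply: cvgB; [exact: cvg_cst|exact: cvg_id].
near (1 : R)^'- => t; exists t; split.
- by apply/andP; split; near: t; [exact: nbhs_left_gt|exact: nbhs_left_lt].
- by near: t; exact: c1.
- by near: t; apply: cvgr_lt c2 _ ab.
Unshelve. all: by end_near. Qed.

(** Near [0] the functions are bounded uniformly in [j], so convexity along the
    segments from [0] turns pointwise information at the contracted points
    [t *: x] into information along sequences converging to [x]. *)
Lemma epi_cvg_criterion hs h :
  (forall j, is_Conv0 (hs j)) -> is_Conv0 h ->
  (exists d M : R, 0 < d /\
    \forall j \near \oo, forall w, `|w| <= d -> (hs j w <= M%:E)%E) ->
  (forall x (a : R), (a%:E < h x)%E -> \forall j \near \oo, (a%:E <= hs j x)%E) ->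
  (exists M : R, forall x (r t e : R), (h x <= r%:E)%E -> 0 < t < 1 -> 0 < e ->
    \forall j \near \oo, (hs j (t *: x)%R <= (t * r + (1 - t) * M + e)%:E)%E) ->
  epi_cvg hs h.
Proof.
move=> ch h0 [d [M [d0 hM]]] hl [M' hu].
have lower x (xs : nat -> V) (a : R) : xs @ \oo --> x -> (a%:E < h x)%E ->
    \forall j \near \oo, (a%:E <= hs j (xs j))%E.
  move=> xsx ahx.
  have lh : lower_semicontinuous h by case: h0 => -[].
  have [b ab /lh[U Ux Ub]] := lt_fin_between ahx.
  (* if hs j (xs j) <= a, convexity gives hs j (t *: x) <= t * a + (1 - t) * M,
     while hs j (t *: x) eventually exceeds b *)
  have [t [t01 Utx tab]] := contraction_near M Ux ab.
  have /andP[t0 t1] := t01.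
  have t1' : 0 < 1 - t by rewrite subr_gt0.
  have e0 : 0 < d * (1 - t) / t by rewrite divr_gt0// mulr_gt0.
  have nx : \forall j \near \oo, `|x - xs j| <= d * (1 - t) / t.
    exact: cvgr_dist_le _ _ xsx _ e0.
  near=> j; rewrite leNgt; apply/negP => /ltW hja.
  have bj : (b%:E <= hs j (t *: x)%R)%E by near: j; apply: hl; exact: Ub.
  pose w := (t / (1 - t)) *: (x - xs j).
  have wd : `|w| <= d.
    rewrite normrZ ger0_norm ?divr_ge0 ?(ltW t0) ?(ltW t1')//.
    rewrite mulrC mulrA ler_pdivrMr// -ler_pdivlMr//.
    by near: j; exact: nx.
  have hw : (hs j w <= M%:E)%E.
    by move: w wd; near: j; exact: hM.
  have t01' : 0 <= t <= 1 by rewrite !ltW.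
  have [[_ _ _ cj] _] := ch j.
  have := econvex_le cj t01' hja hw.
  rewrite (_ : t *: xs j + (1 - t) *: w = t *: x); last first.
    by apply/matrixP => i k; rewrite !mxE; field; rewrite gt_eqF.
  by move=> /(le_trans bj); rewrite lee_fin leNgt tab.
move=> x; split=> [xs xsx|]; first by apply: limn_einf_ge => a; exact: lower.
have hNy : h x != -oo%E by case: h0 => -[].
have [hxy|hxy] := eqVneq (h x) +oo%E.
  exists (fun=> x); first exact: cvg_cst.
  by apply: cvge_of_bounds => [a|b]; [exact: hl|rewrite hxy].
have hxE : h x = (fine (h x))%:E by rewrite fineK// fin_numE hNy.
set r := fine (h x) in hxE.
have hcvg : (m.+2%:R^-1 : R) @[m --> \oo] --> (0 : R).
  have := @cvg_harmonic R; rewrite -(@cvg_shiftS _ (@harmonic R)).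
  exact.
pose t m : R := 1 - m.+2%:R^-1.
have t01 m : 0 < t m < 1.
  by rewrite subr_gt0 invf_lt1// ltr1n/= ltrBlDr ltrDl invr_gt0.
have tcvg : t m @[m --> \oo] --> (1 : R).
  rewrite -[X in _ --> X]subr0; apply: cvgB; first exact: cvg_cst.
  exact: hcvg.
pose g m := t m * r + (1 - t m) * M' + m.+2%:R^-1.
have gcvg : g m @[m --> \oo] --> r.
  rewrite [X in _ --> X](_ : r = 1 * r + (1 - 1) * M' + 0); last by ring.
  apply: cvgD; first by apply: cvgD; apply: cvgMr_tmp => //; apply: cvgB => //; exact: cvg_cst.
  exact: hcvg.
have [|c coo cP] := @diagonal_sequence
    (fun m j => (hs j (t m *: x)%R <= (g m)%:E)%E).
  by move=> m; apply: hu; rewrite ?hxE//.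
have xsx : (t (c j) *: x) @[j --> \oo] --> x.
  rewrite -[X in _ --> X]scale1r; apply: cvgZr_tmp.
  exact: cvg_comp coo tcvg.
exists (fun j => t (c j) *: x) => //.
apply: cvge_of_bounds => [a|b]; first exact: lower.
rewrite hxE lte_fin => rb.
have gc : g (c j) @[j --> \oo] --> r by exact: cvg_comp coo gcvg.
near=> j; apply: (@le_trans _ _ (g (c j))%:E); first by near: j.
by rewrite lee_fin; near: j; apply: cvgr_le gc _ rb.
Unshelve. all: by end_near. Qed.

End epi_criterion.

(** * Integrals of functions bounded below on a set of full measure *)

Section bounded_below_integral.
Context d (T : measurableType d) (R : realType).
Variables (mu : {finite_measure set T -> \bar R}) (K : set T).
Hypotheses (mK : measurable K) (muK : mu (~` K) = 0%E).
Implicit Types (u v w : T -> \bar R).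
Local Open Scope ereal_scope.

(** The functions integrated below may be infinite on sets of positive measure;
    a lower bound on a set of full measure replaces integrability. *)
Definition bounded_below_on u := exists M : R, forall y, K y -> M%:E <= u y.

Lemma measure_setI_full (A : set T) : measurable A -> mu (A `&` K) = mu A.
Proof.
move=> mA; apply/eqP; rewrite eq_le; apply/andP; split.
  by apply: le_measure; rewrite ?inE//; exact: measurableI.
rewrite -[leRHS]adde0 -[X in _ <= _ + X]muK.
apply: le_trans (measureU2 _ _ _) => //.
- apply: le_measure; rewrite ?inE//.
    by apply: measurableU; [exact: measurableI|exact: measurableC].
  by move=> y Ay; have [Ky|nKy] := pselect (K y); [left|right].
- exact: measurableI.
- exact: measurableC.
Qed.

Lemma measure_full_set : mu K = mu setT.
Proof. by rewrite -[in LHS](setTI K) measure_setI_full. Qed.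

Lemma integral_full_set u : measurable_fun setT u ->
  \int[mu]_y u y = \int[mu]_(y in K) u y.
Proof.
move=> mu_; rewrite [RHS]integral_mkcond; apply: ae_eq_integral => //.
  by apply/(measurable_restrictT _ mK); exact: measurable_funS mu_.
exists (~` K); split => //; first exact: measurableC.
move=> y /= h Ky; apply: h => _; rewrite patchE ifT// ?inE//.
Qed.

Lemma bounded_below_shift u : bounded_below_on u ->
  exists M : R, (0 <= M)%R /\ forall y, K y -> 0 <= u y + M%:E.
Proof.
move=> [M uM]; exists `|M|%R; split => // y /uM Mu.
apply: (@le_trans _ _ (M%:E + `|M|%:E)); last exact: leeD2r.
by rewrite -EFinD lee_fin -lerBlDr sub0r lerNnormlW.
Qed.

(** Through this identity the properties of the integrals of nonnegative functions
    extend to functions bounded below. *)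
Lemma integral_shift u (M : R) : measurable_fun setT u -> (0 <= M)%R ->
  (forall y, K y -> 0 <= u y + M%:E) ->
  \int[mu]_y u y = \int[mu]_(y in K) (u y + M%:E) - M%:E * mu setT.
Proof.
move=> mu_ M0 uM; rewrite integral_full_set//.
have muK_ : measurable_fun K u by exact: measurable_funS mu_.
have mu1 : measurable_fun K (fun y => u y + M%:E).
  by apply: emeasurable_funD => //; exact: measurable_cst.
have e1 : \int[mu]_(y in K) (u^\+ y + M%:E) =
    \int[mu]_(y in K) ((u y + M%:E) + u^\- y).
  apply: eq_integral => y /[!inE] /uM; rewrite funeposE funenegE.
  case: (u y) => [r| |] //= _; last by rewrite maxNye// maxye//.
  rewrite -!EFin_max -!EFinD; congr EFin.
  case/orP: (le_total 0%R r) => r0.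
    by rewrite (max_l r0) max_r ?oppr_le0// addr0.
  by rewrite (max_r r0) max_l ?oppr_ge0//; lra.
have mpos := measurable_funepos muK_.
have mneg := measurable_funeneg muK_.
rewrite ge0_integralD// [RHS]ge0_integralD// integral_cst// in e1.
have bfin : \int[mu]_(y in K) u^\- y \is a fin_num.
  rewrite ge0_fin_numE ?integral_ge0//.
  apply: (@le_lt_trans _ _ (\int[mu]_(y in K) cst M%:E y)).
    apply: ge0_le_integral => //.
    move=> y /uM; rewrite funenegE; case: (u y) => [r| |] //= h.
      by move: h; rewrite -EFin_max -EFinD !lee_fin ge_max M0 andbT -lerBlDr; lra.
    by rewrite maxNye lee_fin.
  by rewrite integral_cst// ltey_eq fin_numM// fin_num_measure.
rewrite integralE -measure_full_set.
have mfin : M%:E * mu K \is a fin_num by rewrite fin_numM// fin_num_measure.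
move: e1 bfin mfin; move: (\int[mu]_(y in K) u^\+ y) (M%:E * mu K)
  (\int[mu]_(y in K) (u y + M%:E)) (\int[mu]_(y in K) u^\- y).
move=> [a| |] [m| |] [c| |] [b| |] //=; rewrite -!EFinD => -[h] _ _.
by congr EFin; lra.
Qed.

Lemma le_integral_bounded_below u v : measurable_fun setT u ->
  measurable_fun setT v -> bounded_below_on u ->
  (forall y, K y -> u y <= v y) -> \int[mu]_y u y <= \int[mu]_y v y.
Proof.
move=> mu_ mv /bounded_below_shift[M [M0 uM]] uv.
have vM y : K y -> 0 <= v y + M%:E.
  by move=> Ky; apply: le_trans (uM _ Ky) _; exact/leeD2r/uv.
rewrite (integral_shift mu_ M0 uM) (integral_shift mv M0 vM).
apply: leeD2r; apply: ge0_le_integral => //.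
- by apply: emeasurable_funD; [exact: measurable_funS mu_|exact: measurable_cst].
- by apply: emeasurable_funD; [exact: measurable_funS mv|exact: measurable_cst].
- by move=> y Ky; exact/leeD2r/uv.
Qed.

Lemma integralD_bounded_below u v : measurable_fun setT u ->
  measurable_fun setT v -> bounded_below_on u -> bounded_below_on v ->
  \int[mu]_y (u y + v y) = \int[mu]_y u y + \int[mu]_y v y.
Proof.
move=> mu_ mv /bounded_below_shift[M [M0 uM]] /bounded_below_shift[N [N0 vN]].
have uvE y : u y + v y + (M + N)%:E = (u y + M%:E) + (v y + N%:E).
  by rewrite EFinD addeACA.
have uvMN y : K y -> 0 <= u y + v y + (M + N)%:E.
  by move=> Ky; rewrite uvE adde_ge0 ?uM ?vN.
have MN0 : (0 <= M + N)%R by rewrite addr_ge0.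
have mK' w (c : R) : measurable_fun setT w -> measurable_fun K (fun y => w y + c%:E).
  by move=> mw; apply: emeasurable_funD; [exact: measurable_funS mw|exact: measurable_cst].
rewrite (integral_shift mu_ M0 uM) (integral_shift mv N0 vN).
rewrite (integral_shift (emeasurable_funD mu_ mv) MN0 uvMN).
under eq_integral do rewrite uvE.
rewrite ge0_integralD//; [|exact: mK'|exact: mK'].
have : mu setT \is a fin_num by exact: fin_num_measure.
have := integral_ge0 mu uM; have := integral_ge0 mu vN.
move: (\int[mu]_(y in K) (u y + M%:E)) (\int[mu]_(y in K) (v y + N%:E)) (mu setT).
move=> [a| |] [b| |] [c| |] //= _ _ _; rewrite -?EFinM -?EFinD//.
by congr EFin; ring.
Qed.

Lemma integralZ_bounded_below u (t : R) : (0 <= t)%R -> measurable_fun setT u ->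
  bounded_below_on u -> \int[mu]_y (t%:E * u y) = t%:E * \int[mu]_y u y.
Proof.
move=> t0 mu_ /bounded_below_shift[M [M0 uM]].
have uE y : t%:E * u y + (t * M)%:E = t%:E * (u y + M%:E).
  by rewrite EFinM muleDr// fin_num_adde_defl.
have tuM y : K y -> 0 <= t%:E * u y + (t * M)%:E.
  by move=> Ky; rewrite uE mule_ge0// uM.
have tM0 : (0 <= t * M)%R by rewrite mulr_ge0.
have mtu : measurable_fun setT (fun y => t%:E * u y).
  by apply: emeasurable_funM => //; exact: measurable_cst.
have mK' : measurable_fun K (fun y => u y + M%:E).
  by apply: emeasurable_funD; [exact: measurable_funS mu_|exact: measurable_cst].
rewrite (integral_shift mu_ M0 uM) (integral_shift mtu tM0 tuM).
under eq_integral do rewrite uE.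
have cfin : mu setT \is a fin_num by exact: fin_num_measure.
rewrite ge0_integralZl// [RHS]muleDr// ?fin_num_adde_defl// ?fin_numN ?fin_numM//.
by rewrite muleN EFinM muleA.
Qed.

Lemma integralN_bounded u (m M : R) : measurable_fun setT u ->
  (forall y, K y -> m%:E <= u y <= M%:E) ->
  \int[mu]_y (- u y) = - \int[mu]_y u y.
Proof.
move=> mu_ umM.
have mNu : measurable_fun setT (fun y => - u y) by exact: measurableT_comp.
have bu : bounded_below_on u by exists m => y /umM /andP[].
have bNu : bounded_below_on (fun y => - u y).
  by exists (- M)%R => y /umM /andP[_ uM]; rewrite EFinN leeN2.
have : \int[mu]_y u y + \int[mu]_y (- u y) = 0.
  have /= <- := integralD_bounded_below mu_ mNu bu bNu.
  rewrite integral_full_set; last exact: emeasurable_funD.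
  apply: integral0_eq => y /umM /andP[my yM].
  by rewrite subee// fin_numElt (lt_le_trans _ my) ?ltNyr// (le_lt_trans yM)// ltry.
move: (\int[mu]_y u y) (\int[mu]_y (- u y)) => [a| |] [b| |] //=.
by move=> -[ab]; congr EFin; lra.
Qed.

(** Fatou's lemma for a uniform lower bound that need not be zero. *)
Lemma fatou_bounded_below u (us : nat -> T -> \bar R) (M : R) :
  measurable_fun setT u -> (forall j, measurable_fun setT (us j)) ->
  bounded_below_on u ->
  (\forall j \near \oo, forall y, K y -> M%:E <= us j y) ->
  (forall y (a : R), K y -> a%:E < u y -> \forall j \near \oo, a%:E <= us j y) ->
  \int[mu]_y u y <= limn_einf (fun j => \int[mu]_y us j y).
Proof.
move=> mu_ mus [M1 uM1] usM uus; set N := (`|M| + `|M1|)%R.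
have N0 : (0 <= N)%R by rewrite addr_ge0.
have MN : (- M <= N)%R by rewrite (le_trans (ler_norm (- M)))// normrN lerDl.
have M1N : (- M1 <= N)%R by rewrite (le_trans (ler_norm (- M1)))// normrN lerDr.
have shift (a : R) (x : \bar R) : (- a <= N)%R -> a%:E <= x -> 0 <= x + N%:E.
  move=> aN ax; apply: (@le_trans _ _ (a%:E + N%:E)); last exact: leeD2r.
  by rewrite -EFinD lee_fin -lerBlDl sub0r.
have uN y : K y -> 0 <= u y + N%:E by move=> Ky; exact: shift M1N (uM1 y Ky).
pose vs j y := maxe (us j y + N%:E) 0.
have mD w : measurable_fun setT w -> measurable_fun setT (fun y => w y + N%:E).
  by move=> mw; apply: emeasurable_funD => //; exact: measurable_cst.
have mvs j : measurable_fun K (vs j).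
  apply: (@measurable_funS _ _ _ _ setT) => //.
  by apply: measurable_maxe; [exact: mD|exact: measurable_cst].
have vs0 j y : K y -> 0 <= vs j y by move=> _; rewrite le_max lexx orbT.
have fat := fatou mu mK mvs vs0.
have {fat} h : \int[mu]_(y in K) (u y + N%:E) <=
    limn_einf (fun j => \int[mu]_(y in K) vs j y).
  apply: le_trans fat; apply: ge0_le_integral => //.
  - by apply: (@measurable_funS _ _ _ _ setT) => //; exact: mD.
  - rewrite /limn_einf; apply: measurableT_comp => //.
    by apply: measurable_fun_limn_esup => j; exact: measurableT_comp.
  - move=> y Ky; apply: limn_einf_ge => a auN.
    have aN : (a - N)%:E < u y by rewrite EFinB lteBlDr.
    apply: filterS (uus y _ Ky aN) => j; rewrite EFinB leeBlDr// => h.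
    by rewrite le_max h.
have cfin : mu setT \is a fin_num by exact: fin_num_measure.
have Nfin : N%:E * mu setT \is a fin_num by rewrite fin_numM.
rewrite (integral_shift mu_ N0 uN); apply: limn_einf_ge => a.
rewrite lteBrDr// -(fineK Nfin) -EFinD => aI.
have := limn_einf_gt h aI; apply: filterS2 usM => j usMj.
have usN y : K y -> 0 <= us j y + N%:E by move=> Ky; exact: shift MN (usMj y Ky).
rewrite (integral_shift (mus j) N0 usN) => aIj.
rewrite leeBrDr// -{1}(fineK Nfin) -EFinD; apply: le_trans (ltW aIj) _.
rewrite le_eqVlt; apply/orP; left; apply/eqP; apply: eq_integral => y /[!inE] Ky.
by rewrite /vs max_l// usN.
Qed.

Lemma integral_lty_exists u (A : set T) : measurable_fun setT u ->
  bounded_below_on u -> \int[mu]_y u y < +oo -> measurable A -> 0 < mu A ->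
  exists2 y, A y & u y < +oo.
Proof.
move=> mu_ /bounded_below_shift[M [M0 uM]] ulty mA A0; apply: contrapT => uA.
have uAy y : A y -> u y = +oo.
  move=> Ay; apply/eqP; rewrite -leye_eq leNgt; apply/negP => uy.
  by apply: uA; exists y.
have KA0 : 0 < mu (K `&` A) by rewrite setIC measure_setI_full.
move: ulty; rewrite (integral_shift mu_ M0 uM) ltNge => /negP; apply.
rewrite leye_eq; apply/eqP.
suff -> : \int[mu]_(y in K) (u y + M%:E) = +oo.
  have : - (M%:E * mu setT) \is a fin_num by rewrite fin_numN fin_numM// fin_num_measure.
  by rewrite fin_numE => /andP[h _]; rewrite addye.
apply/eqP; rewrite -leye_eq.
have mKA : measurable (K `&` A) by exact: measurableI.
apply: (@le_trans _ _ (\int[mu]_(y in K `&` A) (u y + M%:E))).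
  rewrite (eq_integral (cst +oo)); last by move=> y /[!inE] -[_ /uAy ->].
  by rewrite integral_cst// gt0_mulye.
apply: ge0_subset_integral => //.
by apply: emeasurable_funD; [exact: measurable_funS mu_|exact: measurable_cst].
Qed.

End bounded_below_integral.

(** * Differences of continuous convex functions *)

Section continuous_convex.
Context {R : realType} {n : nat}.
Notation V := 'cV[R]_n.
Implicit Types (g h : V -> R) (x y z : V).

Definition real_convex g : Prop := forall x y (t : R), 0 <= t <= 1 ->
  g (t *: x + (1 - t) *: y) <= t * g x + (1 - t) * g y.

Definition cconvex g : Prop := continuous g /\ real_convex g.

Lemma real_convex_econvex g : real_convex g -> econvex (EFin \o g).
Proof. by move=> cg x y t t01; rewrite /= -!EFinM -EFinD lee_fin cg. Qed.

Lemma real_convex_continuous g : real_convex g ->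
  (forall z, exists d M : R, 0 < d /\ forall w, `|w - z| <= d -> g w <= M) ->
  continuous g.
Proof.
move=> cg gM z; have [d [M [d0 zM]]] := gM z.
have ecg := real_convex_econvex cg.
have zM' w : `|w - z| <= d -> ((EFin \o g) w <= M%:E)%E.
  by move=> wd; rewrite lee_fin zM.
have lo x : g z - `|x - z| / d * (M - g z) <= g x.
  by rewrite -lee_fin; exact: (econvex_lower_bound ecg d0 zM' (lexx _)).
have up x : `|x - z| <= d -> g x <= g z + `|x - z| / d * (M - g z).
  by move=> xd; rewrite -lee_fin; exact: (econvex_upper_bound ecg d0 zM' (lexx _)).
have gzM : g z <= M by apply: zM; rewrite subrr normr0 ltW.
apply/(@cvgrPdist_le _ _ _ (nbhs z) (nbhs_filter z)) => e e0.
pose C := (M - g z) / d + 1.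
have C0 : 0 < C by rewrite ltr_wpDl// divr_ge0 ?subr_ge0// ltW.
have dC0 : 0 < Num.min d (e / C) by rewrite lt_min d0 divr_gt0.
apply: filterS (@cvgr_dist_le _ _ _ (nbhs z) (nbhs_filter z) id z cvg_id _ dC0).
move=> x /=; rewrite distrC le_min => /andP[xd xe].
have {}xe : `|x - z| / d * (M - g z) <= e.
  apply: le_trans (_ : `|x - z| * C <= _); last by rewrite -ler_pdivlMr.
  by rewrite mulrAC -mulrA ler_wpM2l// lerDl.
rewrite ler_distl; apply/andP; split.
  by rewrite lerBlDr (le_trans (up _ xd))// lerD2l.
by rewrite -lerBlDr (le_trans _ (lo x))// lerD2l lerN2.
Qed.

Lemma cconvex_cst (c : R) : cconvex (fun=> c).
Proof.
split; first exact: cst_continuous.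
by move=> x y t _; rewrite le_eqVlt; apply/orP; left; apply/eqP; ring.
Qed.

Lemma cconvexD g h : cconvex g -> cconvex h -> cconvex (fun x => g x + h x).
Proof.
move=> [gc cg] [hc ch]; split => [x|x y t t01].
  by apply: (@cvgD _ _ _ _ (nbhs_filter x)); [exact: gc|exact: hc].
by apply: le_trans (lerD (cg x y t t01) (ch x y t t01)) _; lra.
Qed.

Lemma cconvex_max g h : cconvex g -> cconvex h ->
  cconvex (fun x => Num.max (g x) (h x)).
Proof.
move=> [gc cg] [hc ch]; split => [x|x y t t01].
  exact: (max_fun_continuous gc hc).
have /andP[t0 t1] := t01; have t1' : 0 <= 1 - t by rewrite subr_ge0.
rewrite ge_max; apply/andP; split.
  by apply: le_trans (cg x y t t01) _; apply: lerD; apply: ler_wpM2l;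
    rewrite // le_max lexx.
by apply: le_trans (ch x y t t01) _; apply: lerD; apply: ler_wpM2l;
  rewrite // le_max lexx orbT.
Qed.

Lemma cconvex_mulmx g (A : 'M[R]_n) : cconvex g -> cconvex (fun x => g (A *m x)).
Proof.
move=> [gc cg]; split => [x|x y t t01].
  by apply: continuous_comp; [exact: mulmx_continuous|exact: gc].
by rewrite mulmxDr -!scalemxAr cg.
Qed.

Lemma cconvex_is_Conv0 g : cconvex g -> is_Conv0 (EFin \o g).
Proof.
move=> [gc cg]; split; last by apply: filterE.
split => //; first by exists 0.
  move=> x a /=; rewrite lte_fin => agx; exists [set y | a < g y] => //.
  by apply: (gc x [set z | a < z]); exact: lt_nbhsr.
Qed.

(** These differences form a vector lattice, to which monotone additive
    functionals on convex functions extend. *)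
Definition dc h : Prop := exists g1 g2, [/\ cconvex g1, cconvex g2 &
  forall x, h x = g1 x - g2 x].

Lemma dc_continuous h : dc h -> continuous h.
Proof.
move=> [g1 [g2 [[g1c _] [g2c _] hE]]]; rewrite (_ : h = fun x => g1 x - g2 x).
  by move=> x; apply: (@cvgB _ _ _ _ (nbhs_filter x)); [exact: g1c|exact: g2c].
exact/funext.
Qed.

Lemma cconvex_dc g : cconvex g -> dc g.
Proof.
by move=> cg; exists g, (fun=> 0); split => // [|x]; [exact: cconvex_cst|rewrite subr0].
Qed.

Lemma dc_cst (c : R) : dc (fun=> c).
Proof. exact/cconvex_dc/cconvex_cst. Qed.

Lemma dcD h h' : dc h -> dc h' -> dc (fun x => h x + h' x).
Proof.
move=> [g1 [g2 [c1 c2 hE]]] [g1' [g2' [c1' c2' hE']]].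
exists (fun x => g1 x + g1' x), (fun x => g2 x + g2' x).
by split => [||x]; [exact: cconvexD|exact: cconvexD|rewrite hE hE'; ring].
Qed.

Lemma dcN h : dc h -> dc (fun x => - h x).
Proof.
move=> [g1 [g2 [c1 c2 hE]]]; exists g2, g1; split => // x.
by rewrite hE opprB.
Qed.

Lemma dcB h h' : dc h -> dc h' -> dc (fun x => h x - h' x).
Proof. by move=> dh dh'; apply: dcD dh _; exact: dcN. Qed.

Lemma dc_max h h' : dc h -> dc h' -> dc (fun x => Num.max (h x) (h' x)).
Proof.
move=> [g1 [g2 [c1 c2 hE]]] [g1' [g2' [c1' c2' hE']]].
(* adding g2 + g2' to both differences makes them convex *)
exists (fun x => Num.max (g1 x + g2' x) (g1' x + g2 x)), (fun x => g2 x + g2' x).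
split => [||x]; [by apply: cconvex_max; exact: cconvexD|exact: cconvexD|].
rewrite addr_maxl hE hE'; congr Num.max; ring.
Qed.

Lemma dc_min h h' : dc h -> dc h' -> dc (fun x => Num.min (h x) (h' x)).
Proof.
move=> dh dh'; rewrite (_ : (fun x => _) = (fun x => - Num.max (- h x) (- h' x))).
  by apply: dcN; apply: dc_max; exact: dcN.
by apply/funext => x; rewrite oppr_max !opprK.
Qed.

Lemma dcMn h k : dc h -> dc (fun x => h x *+ k).
Proof.
move=> dh; elim: k => [|k IH]; first exact: dc_cst.
under eq_fun do rewrite mulrS; exact: dcD.
Qed.

Lemma dc_sum (I : Type) (s : seq I) (F : I -> V -> R) :
  (forall i, dc (F i)) -> dc (fun x => \sum_(i <- s) F i x).
Proof.
move=> dF; elim: s => [|i s IH].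
  by under eq_fun do rewrite big_nil; exact: dc_cst.
by under eq_fun do rewrite big_cons; exact: dcD.
Qed.

(** The squared Euclidean distance to a set [C] is the squared Euclidean norm of
    [x] minus the supremum over the points [c] of [C] of the affine functions
    [2 <x, c> - <c, c>]. For [C] the complement of [U], the truncations of its
    multiples are bumps increasing to the indicator of [U]. *)
Lemma open_dc_distance (U : set V) : open U ->
  exists h, [/\ dc h, forall x, 0 <= h x, forall x, U x -> 0 < h x &
    forall x, ~ U x -> h x = 0].
Proof.
move=> oU; have [[c0 Uc0]|UT] := pselect (exists c, ~ U c); last first.
  exists (fun=> 1); split => // [|x nUx]; first exact: dc_cst.
  by exfalso; apply: UT; exists x.
pose sq (x : V) := \sum_i (x i 0) ^+ 2.
pose q (c x : V) := \sum_i (2 * x i 0 * c i 0 - c i 0 ^+ 2).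
have sqB x c : sq x - q c x = \sum_i (x i 0 - c i 0) ^+ 2.
  by rewrite -sumrB; apply: eq_bigr => i _; ring.
have q_sq c x : q c x <= sq x.
  by rewrite -subr_ge0 sqB sumr_ge0// => i _; exact: sqr_ge0.
pose S x := [set q c x | c in ~` U].
have S_ub x : has_ubound (S x) by exists (sq x) => _ [c _ <-].
have S0 x : S x !=set0 by exists (q c0 x), c0.
pose phi x := sup (S x).
have q_phi c x : ~ U c -> q c x <= phi x.
  by move=> Uc; apply: ub_le_sup => //; exists c.
have phi_sq x : phi x <= sq x by apply: ge_sup => // _ [c _ <-].
have sq_conv : real_convex sq.
  move=> x y t /andP[t0 t1]; rewrite !mulr_sumr -big_split/=; apply: ler_sum => i _.
  rewrite !mxE -subr_ge0 [leRHS](_ : _ = t * (1 - t) * (x i 0 - y i 0) ^+ 2).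
    by rewrite mulr_ge0 ?sqr_ge0// mulr_ge0 ?subr_ge0.
  ring.
have phi_conv : real_convex phi.
  move=> x y t /andP[t0 t1]; apply: ge_sup => // _ [c Uc <-].
  rewrite (_ : q c _ = t * q c x + (1 - t) * q c y); last first.
    rewrite !mulr_sumr -big_split/=; apply: eq_bigr => i _; rewrite !mxE; ring.
  by apply: lerD; apply: ler_wpM2l; rewrite ?subr_ge0//; exact: q_phi.
have sq_loc z : exists d M : R, 0 < d /\ forall w, `|w - z| <= d -> sq w <= M.
  exists 1, (\sum_(i < n) (1 + `|z|) ^+ 2); split => // w w1; apply: ler_sum => i _.
  rewrite -real_normK ?num_real// ler_pXn2r ?nnegrE ?addr_ge0//.
  apply: le_trans (mx_coord_le_norm w i 0) _.
  by rewrite -[w](subrK z) (le_trans (ler_normD _ _))// lerD2r.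
exists (fun x => sq x - phi x); split.
- exists sq, phi; split => //; split => //; apply: real_convex_continuous => // z.
  have [d [M [d0 zM]]] := sq_loc z; exists d, M; split => // w /zM.
  exact: le_trans.
- by move=> x; rewrite subr_ge0.
- move=> x Ux; have /nbhs_normP[r /= r0 rU] : nbhs x U by exact: open_nbhs_nbhs.
  apply: (@lt_le_trans _ _ (r ^+ 2)); first exact: exprn_gt0.
  rewrite lerBrDl -lerBrDr; apply: ge_sup => // _ [c Uc <-].
  rewrite lerBrDl -lerBrDr sqB.
  have /existsNP[i /negP] : ~ forall i, `|(x - c) i 0| < r.
    move=> xc; apply: Uc; apply: rU => /=.
    rewrite (_ : `|x - c| = mx_norm (x - c))// mx_normrE.
    by apply/bigmax_ltP; split => // -[i j] _ /=; rewrite ord1 xc.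
  rewrite -leNgt => ri; rewrite (bigD1 i)//= -[leLHS]addr0 lerD//.
    rewrite !mxE in ri; rewrite -(real_normK (num_real (x i 0 - c i 0))).
    by rewrite ler_pXn2r ?nnegrE// ltW.
  by rewrite sumr_ge0// => j _; exact: sqr_ge0.
- move=> x nUx; apply/eqP; rewrite eq_le subr_ge0 phi_sq andbT subr_le0.
  apply: le_trans (q_phi x x nUx).
  by rewrite -subr_le0 sqB big1// => i _; rewrite subrr expr0n.
Qed.

Lemma continuous_bounded_on (B : set V) h : compact B -> continuous h ->
  exists M : nat, forall x, B x -> `|h x| <= M%:R.
Proof.
move=> Bc hc.
have [M [_ MB]] : bounded_set ((h : V -> R^o) @` B).
  by apply: compact_bounded; apply: continuous_compact => //; exact: continuous_subspaceT.
exists (Num.truncn M).+1 => x Bx; apply: MB; first exact: truncnS_gt.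
by exists x.
Qed.

End continuous_convex.

(** * Borel measurability *)

Section borel_measurability.
Context {R : realType} {n : nat}.

Lemma lower_semicontinuous_borel (f : 'cV[R]_n -> \bar R) :
  lower_semicontinuous f -> measurable_fun setT (f : borelRn R n -> \bar R).
Proof.
move=> /lower_semicontinuousP of_.
apply: (measurability _ (ErealGenOInfty.measurableE R)) => //.
move=> _ [_ [a ->] <-]; rewrite setTI preimage_itvoy.
by apply: sub_sigma_algebra; exact: of_.
Qed.

Lemma open_borel (U : set 'cV[R]_n) : open U -> measurable (U : set (borelRn R n)).
Proof. exact: sub_sigma_algebra. Qed.

Lemma closed_borel (C : set 'cV[R]_n) : closed C -> measurable (C : set (borelRn R n)).
Proof.
move=> cC; rewrite -(setCK C); apply: measurableC.
by apply: open_borel; exact: closed_openC.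
Qed.

Lemma continuous_borel (g : 'cV[R]_n -> R) : continuous g ->
  measurable_fun setT (fun y : borelRn R n => (g y)%:E).
Proof.
move=> gc; apply: lower_semicontinuous_borel => x a.
rewrite lte_fin => agx; exists [set y | a < g y] => //.
by apply: (gc x [set z | a < z]); exact: lt_nbhsr.
Qed.

End borel_measurability.

(** * Positive functionals on convex functions *)

Section real_sums.
Context {R : realType}.

Lemma le_of_le_harmonic (a b c : R) :
  (forall m : nat, (0 < m)%N -> a <= b + c / m%:R) -> a <= b.
Proof.
move=> H; apply/ler_addgt0Pr => e e0.
have [c0|c0] := leP c 0.
  by have := H 1%N isT; rewrite divr1; lra.
have cm : c / e < (Num.truncn (c / e)).+1%:R by exact: truncnS_gt.
apply: le_trans (H (Num.truncn (c / e)).+1 isT) _; rewrite lerD2l.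
by rewrite ler_pdivrMr ?ltr0n// mulrC -ler_pdivrMr// ltW.
Qed.

Lemma sum_unit_layers (t : R) (N : nat) : 0 <= t <= N%:R ->
  \sum_(k < N) (Num.min t k.+1%:R - Num.min t k%:R) = t.
Proof.
move=> /andP[t0 tN].
rewrite -(big_mkord xpredT (fun k => Num.min t k.+1%:R - Num.min t k%:R)).
rewrite (telescope_sumr (fun k => Num.min t k%:R))//.
by rewrite (min_idPl tN) (min_idPr t0) subr0.
Qed.

Lemma sum_unit_steps (t : R) (N : nat) : 0 <= t ->
  \sum_(k < N) (k%:R < t)%R%:R <= t + 1.
Proof.
move=> t0; elim: N => [|N IH]; first by rewrite big_ord0 addr_ge0.
rewrite big_ord_recr/=; have [Nt|_] := ltP N%:R t; last by rewrite addr0.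
rewrite lerD2r; apply: le_trans (ltW Nt).
apply: (@le_trans _ _ (\sum_(k < N) 1)); last by rewrite sumr_const card_ord.
by apply: ler_sum => k _; case: (_ < _).
Qed.

End real_sums.

Section convex_riesz.
Context {R : realType} {n : nat}.
Notation V := 'cV[R]_n.
Variables (B : set V) (G : (V -> R) -> R).
Hypotheses (Bc : compact B)
  (GD : forall g h, cconvex g -> cconvex h -> G (fun x => g x + h x) = G g + G h)
  (Gle : forall g h, cconvex g -> cconvex h -> (forall x, B x -> g x <= h x) -> G g <= G h).
Implicit Types (g h : V -> R) (U W : set V).

(** The extension of [G] to differences of convex functions; additivity makes it
    independent of the decomposition. *)
Definition dc_ext h : R := xget 0 [set r | exists g1 g2,
  [/\ cconvex g1, cconvex g2, forall x, h x = g1 x - g2 x & r = G g1 - G g2]].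

Local Notation L := dc_ext.

Lemma dc_extE h g1 g2 : cconvex g1 -> cconvex g2 ->
  (forall x, h x = g1 x - g2 x) -> L h = G g1 - G g2.
Proof.
move=> c1 c2 hE; rewrite /dc_ext; case: xgetP => [r _|]; last first.
  by move=> /(_ (G g1 - G g2)) []; exists g1, g2.
move=> [k1 [k2 [d1 d2 hE' ->]]].
suff : G k1 + G g2 = G g1 + G k2 by lra.
rewrite -!GD//; congr G; apply/funext => x.
by have := hE x; rewrite hE'; lra.
Qed.

Lemma dc_extD h h' : dc h -> dc h' -> L (fun x => h x + h' x) = L h + L h'.
Proof.
move=> [g1 [g2 [c1 c2 hE]]] [g1' [g2' [c1' c2' hE']]].
rewrite (dc_extE c1 c2 hE) (dc_extE c1' c2' hE').
rewrite (@dc_extE _ (fun x => g1 x + g1' x) (fun x => g2 x + g2' x)).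
- by rewrite !GD//; ring.
- exact: cconvexD.
- exact: cconvexD.
- by move=> x; rewrite hE hE'; ring.
Qed.

Lemma dc_ext0 : L (fun=> 0) = 0.
Proof.
by rewrite (dc_extE (cconvex_cst 0) (cconvex_cst 0)) ?subrr// => x; rewrite subrr.
Qed.

Lemma dc_extN h : dc h -> L (fun x => - h x) = - L h.
Proof.
move=> dh; apply/eqP; rewrite -subr_eq0 opprK -dc_extD//; last exact: dcN.
by under [X in L X]eq_fun do rewrite addNr; rewrite dc_ext0.
Qed.

Lemma dc_extMn h k : dc h -> L (fun x => h x *+ k) = L h *+ k.
Proof.
move=> dh; elim: k => [|k IH]; first exact: dc_ext0.
under [X in L X]eq_fun do rewrite mulrS.
by rewrite dc_extD ?mulrS ?IH//; exact: dcMn.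
Qed.

Lemma dc_ext_sum (I : Type) (s : seq I) (F : I -> V -> R) :
  (forall i, dc (F i)) -> L (fun x => \sum_(i <- s) F i x) = \sum_(i <- s) L (F i).
Proof.
move=> dF; elim: s => [|i s IH].
  by rewrite big_nil; under [X in L X]eq_fun do rewrite big_nil; exact: dc_ext0.
rewrite big_cons -IH -dc_extD//; last exact: dc_sum.
by congr L; apply/funext => x; rewrite big_cons.
Qed.

Lemma dc_ext_le h h' : dc h -> dc h' -> (forall x, B x -> h x <= h' x) -> L h <= L h'.
Proof.
move=> [g1 [g2 [c1 c2 hE]]] [g1' [g2' [c1' c2' hE']]] hh'.
rewrite (dc_extE c1 c2 hE) (dc_extE c1' c2' hE').
suff : G g1 + G g2' <= G g1' + G g2 by lra.
rewrite -!GD//; apply: Gle; [exact: cconvexD|exact: cconvexD|].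
by move=> x /hh'; rewrite hE hE'; lra.
Qed.

Lemma dc_ext_cconvex g : cconvex g -> L g = G g.
Proof.
move=> cg; rewrite (@dc_extE g (fun x => g x + 0) (fun=> 0)).
- by rewrite GD//; [ring|exact: cconvex_cst].
- by apply: cconvexD => //; exact: cconvex_cst.
- exact: cconvex_cst.
- by move=> x; ring.
Qed.

Definition below_indicator U h := [/\ dc h, forall x, h x <= 1 & forall x, ~ U x -> h x <= 0].

Definition open_mass U : \bar R := ereal_sup [set (L h)%:E | h in below_indicator U].

Local Notation lam := open_mass.

Lemma below_indicator0 U : below_indicator U (fun=> 0).
Proof. by split=> //; exact: dc_cst. Qed.

Lemma open_mass_ge0 U : (0 <= lam U)%E.
Proof.
by apply: ereal_sup_ubound; exists (fun=> 0); rewrite ?dc_ext0//; exact: below_indicator0.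
Qed.

Lemma le_open_mass U W : U `<=` W -> (lam U <= lam W)%E.
Proof.
move=> UW; apply: ereal_sup_le => _ [h [dh h1 hU] <-]; exists h => //.
by split=> // x nWx; apply: hU => /UW.
Qed.

Lemma open_mass_ub U h : below_indicator U h -> ((L h)%:E <= lam U)%E.
Proof. by move=> uh; apply: ereal_sup_ubound; exists h. Qed.

Lemma open_massT : lam setT = (L (fun=> 1))%:E.
Proof.
have d1 := @dc_cst R n 1.
have u1 : below_indicator setT (fun=> 1) by split => // x; case.
apply/eqP; rewrite eq_le open_mass_ub ?andbT//.
apply: ge_ereal_sup => _ [h [dh h1 _] <-]; rewrite lee_fin.
by apply: dc_ext_le => // x _; exact: h1.
Qed.

Lemma dc_ext_inv (m : nat) : (0 < m)%N -> L (fun=> m%:R^-1) = L (fun=> 1) / m%:R.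
Proof.
move=> m0; apply: (@mulIf _ m%:R); first by rewrite pnatr_eq0 -lt0n.
rewrite divfK ?pnatr_eq0 -?lt0n// mulr_natr -dc_extMn; last exact: dc_cst.
by congr L; apply/funext => x; rewrite -[LHS]mulr_natr mulVf// pnatr_eq0 -lt0n.
Qed.

(** Compactness reduces the cover of the superlevel set of a function [h] below
    the indicator of the union to finitely many bumps, one for each open set. *)
Lemma open_mass_sigma_subadditive (F : nat -> set V) : (forall i, open (F i)) ->
  (lam (\bigcup_i F i) <= \sum_(i <oo) lam (F i))%E.
Proof.
move=> oF; apply: ge_ereal_sup => _ [h [dh h1 hF] <-].
have [D /all_and4[Ddc D0 DF DnF]] := choice (fun i => open_dc_distance (oF i)).
pose bump k i x := Num.min 1 (D i x *+ k).
have dbump k i : dc (bump k i) by apply: dc_min; [exact: dc_cst|exact: dcMn].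
have ubump k i : below_indicator (F i) (bump k i).
  split => // [x|x nFx]; rewrite /bump ge_min ?lexx// DnF// mul0rn.
  by rewrite lexx orbT.
have bump0 k i x : 0 <= bump k i x by rewrite le_min ler01 mulrn_wge0.
have claim (m : nat) : (0 < m)%N ->
    exists N : nat, L h <= \sum_(i < N) L (bump N i) + L (fun=> 1) / m%:R.
  move=> m0.
  pose K := B `&` [set x | m%:R^-1 <= h x].
  have cK : compact K.
    apply: compact_closedI => //.
    exact: (closed_comp (fun u _ => @dc_continuous _ _ _ dh u) (@closed_ge _ _)).
  have /compact_near_coveringP := cK.
  move=> /(_ nat \oo (fun N x => exists2 i : nat, (i < N)%N & 1 <= D i x *+ N)) [].
    move=> x [Bx hx].
    have [i Fx] : exists i, F i x.
      apply: contrapT => nF; suff : h x <= 0.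
        by apply/negP; rewrite -ltNge (lt_le_trans _ hx)// invr_gt0 ltr0n.
      by apply: hF => -[i _ Fx]; apply: nF; exists i.
    pose N0 := (Num.truncn (D i x / 2)^-1).+1.
    have Dx2 : 0 < D i x / 2 by rewrite divr_gt0// DF.
    have nD : \forall y \near x, D i x / 2 < D i y.
      apply: (dc_continuous (Ddc i) (x := x) (t := [set z | D i x / 2 < z])).
      apply: lt_nbhsr; rewrite ltr_pdivrMr// ltr_pMr ?ltr1n// DF//.
    exists ([set y | D i x / 2 < D i y], [set N | (maxn N0 i.+1 <= N)%N]).
      by split => //=; exists (maxn N0 i.+1).
    move=> [y N] [/= Dy]; rewrite geq_max => /andP[N0N iN]; exists i => //.
    rewrite -mulr_natr -ler_pdivrMl; last exact: lt_trans Dy.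
    rewrite mulr1; apply: (@le_trans _ _ N0%:R); last by rewrite ler_nat.
    apply: (@le_trans _ _ (D i x / 2)^-1); last exact/ltW/truncnS_gt.
    by rewrite lef_pV2 ?posrE ?ltW// (lt_trans Dx2).
  move=> N _ /(_ N (leqnn N)) KN; exists N.
  rewrite -dc_ext_inv// -dc_ext_sum// -dc_extD; [|exact: dc_sum|exact: dc_cst].
  apply: dc_ext_le => //.
    by apply: dcD; [exact: dc_sum|exact: dc_cst].
  move=> x Bx; have [hx|/ltW hx] := leP m%:R^-1 (h x); last first.
    by apply: le_trans hx _; rewrite lerDr sumr_ge0.
  have [i iN Di] := KN x (conj Bx hx).
  apply: le_trans (h1 x) _; rewrite (bigD1 (Ordinal iN))//= {1}/bump min_l//.
  by rewrite -addrA lerDl addr_ge0 ?invr_ge0// sumr_ge0.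
have [Soo|] := eqVneq (\sum_(i <oo) lam (F i))%E +oo%E; first by rewrite Soo leey.
have S0 : (0 <= \sum_(i <oo) lam (F i))%E.
  by apply: nneseries_ge0 => i _ _; exact: open_mass_ge0.
move=> Sfin; rewrite -[leRHS]fineK ?ge0_fin_numE ?ltey// lee_fin.
apply: (@le_of_le_harmonic _ _ _ (L (fun=> 1))) => m m0.
have [N hN] := claim m m0; apply: le_trans hN _; rewrite lerD2r.
rewrite -lee_fin fineK ?ge0_fin_numE ?ltey// -sumEFin.
apply: (@le_trans _ _ (\sum_(i < N) lam (F i))%E).
  by apply: lee_sum => i _; exact: open_mass_ub.
rewrite -(big_mkord xpredT (fun i => lam (F i))).
apply: (@nneseries_lim_ge _ (fun i => lam (F i)) xpredT) => i _ _.
exact: open_mass_ge0.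
Qed.

Lemma open_mass_fin U : lam U \is a fin_num.
Proof.
rewrite ge0_fin_numE ?open_mass_ge0//.
by apply: le_lt_trans (le_open_mass (@subsetT _ U)) _; rewrite open_massT ltry.
Qed.

Definition outer_mass (A : set V) : \bar R :=
  ereal_inf [set lam U | U in [set U | open U /\ A `<=` U]].

Local Notation outer := outer_mass.

Lemma outer_mass_open U : open U -> outer U = lam U.
Proof.
move=> oU; apply/eqP; rewrite eq_le; apply/andP; split.
  by apply: ereal_inf_lbound; exists U => //; split.
by apply: le_ereal_inf_tmp => _ [W [_ UW] <-]; exact: le_open_mass.
Qed.

Lemma outer_mass_le A U : open U -> A `<=` U -> (outer A <= lam U)%E.
Proof. by move=> oU AU; apply: ereal_inf_lbound; exists U. Qed.

Lemma outer_mass_ge0 A : (0 <= outer A)%E.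
Proof. by apply: le_ereal_inf_tmp => _ [W _ <-]; exact: open_mass_ge0. Qed.

Lemma outer_mass_fin A : outer A \is a fin_num.
Proof.
rewrite ge0_fin_numE ?outer_mass_ge0//.
apply: le_lt_trans (outer_mass_le openT (@subsetT _ A)) _.
by rewrite ltey_eq open_mass_fin.
Qed.

Lemma le_outer_mass : {homo outer : A C / A `<=` C >-> (A <= C)%E}.
Proof.
move=> A C AC; apply: le_ereal_inf_tmp => _ [W [oW CW] <-].
by apply: outer_mass_le => //; exact: subset_trans CW.
Qed.

Lemma outer_mass0 : outer set0 = 0%E.
Proof.
rewrite outer_mass_open; last exact: open0.
apply/eqP; rewrite eq_le open_mass_ge0 andbT.
apply: ge_ereal_sup => _ [h [dh _ h0] <-]; rewrite lee_fin -dc_ext0.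
by apply: dc_ext_le => //; [exact: dc_cst|move=> x _; exact: h0].
Qed.

Lemma outer_mass_sigma_subadditive : sigma_subadditive outer.
Proof.
move=> A; apply/lee_addgt0Pr => e e0.
apply: le_trans (epsilon_trick xpredT (fun i => outer_mass_ge0 (A i)) (ltW e0)).
have /choice[F FA] : forall i, exists U, [/\ open U, A i `<=` U &
    (lam U <= outer (A i) + (e / (2 ^ i.+1)%:R)%:E)%E].
  move=> i; have ei : 0 < e / (2 ^ i.+1)%:R by rewrite divr_gt0// ltr0n expn_gt0.
  have [_ [U [oU AU] <-] /ltW UA] := lb_ereal_inf_adherent ei (outer_mass_fin (A i)).
  by exists U.
have oF i : open (F i) by have [] := FA i.
apply: le_trans (_ : (lam (\bigcup_i F i) <= _)%E).
  apply: outer_mass_le; first exact: bigcup_open.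
  by apply: subset_bigcup => i _; have [] := FA i.
apply: le_trans (open_mass_sigma_subadditive oF) _.
apply: lee_nneseries => [i _ _|i _]; first exact: open_mass_ge0.
by have [] := FA i.
Qed.

HB.instance Definition _ := isOuterMeasure.Build R V outer
  outer_mass0 outer_mass_ge0 le_outer_mass outer_mass_sigma_subadditive.

(** A function below the indicator of [W `&` U] is at most [1/m] off the closed
    set [K] where it is at least [1/m]; up to [1/m] it can therefore be added to
    a function below the indicator of [W `\` K] and stay below that of [W]. *)
Lemma open_caratheodory U : open U -> outer.-caratheodory U.
Proof.
move=> oU; apply: le_caratheodory_measurable => X.
apply: le_ereal_inf_tmp => _ [W [oW XW] <-].
apply: (@le_trans _ _ (lam (W `&` U) + outer (X `&` ~` U))%E).
  apply: leeD2r; apply: outer_mass_le; first exact: openI.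
  by move=> x [Xx Ux]; split => //; exact: XW.
rewrite -leeBrDr ?outer_mass_fin//.
apply: ge_ereal_sup => _ [h [dh h1 hWU] <-].
set r := outer _; have rE : r = (fine r)%:E by rewrite fineK// outer_mass_fin.
have WE : lam W = (fine (lam W))%:E by rewrite fineK// open_mass_fin.
rewrite rE WE -EFinB lee_fin.
apply: (@le_of_le_harmonic _ _ _ (L (fun=> 1))) => m m0.
pose W' := W `&` [set x | h x < m%:R^-1].
have oW' : open W'.
  apply: openI => //.
  by apply: (open_comp _ (@open_lt _ m%:R^-1)) => x _; exact: dc_continuous.
have XW' : X `&` ~` U `<=` W'.
  move=> x [Xx Ux]; split; first exact: XW.
  rewrite /=; apply: (@le_lt_trans _ _ 0); last by rewrite invr_gt0 ltr0n.
  by apply: hWU => -[].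
have /le_trans rW' := outer_mass_le oW' XW'.
suff : (lam W' <= (fine (lam W) - L h + L (fun=> 1) / m%:R)%:E)%E.
  by move=> /rW'; rewrite -/r rE lee_fin; lra.
apply: ge_ereal_sup => _ [g [dg g1 gW'] <-]; rewrite lee_fin.
have dm := @dc_cst R n (- m%:R^-1).
have dhg : dc (fun x => h x + g x) by exact: dcD.
have : (L (fun x => (h x + g x) + - m%:R^-1)) <= fine (lam W).
  rewrite -lee_fin -WE; apply: open_mass_ub; split; first exact: dcD.
    move=> x; have [/ltW hm|hm] := ltP (h x) m%:R^-1.
      by have := g1 x; lra.
    have : g x <= 0 by apply: gW' => -[_] /=; rewrite ltNge hm.
    have : 0 < (m%:R^-1 : R) by rewrite invr_gt0 ltr0n.
    by have := h1 x; lra.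
  move=> x nWx; have : g x <= 0 by apply: gW' => -[].
  have : h x <= 0 by apply: hWU => -[].
  have : 0 < (m%:R^-1 : R) by rewrite invr_gt0 ltr0n.
  by lra.
rewrite dc_extD// dc_extD// dc_extN ?dc_ext_inv//; last exact: dc_cst.
by lra.
Qed.

Definition riesz_mass (A : set (borelRn R n)) : \bar R := outer A.

Lemma borel_caratheodory (A : set (borelRn R n)) :
  measurable A -> outer.-caratheodory A.
Proof.
have : <<s @open V >> `<=` outer.-cara.-measurable.
  apply: smallest_sub; last by move=> U /open_caratheodory.
  exact: sigma_algebra_measurable.
by move=> h /h.
Qed.

Let riesz_mass0 : riesz_mass set0 = 0%E.
Proof. exact: outer_mass0. Qed.

Let riesz_mass_ge0 A : (0 <= riesz_mass A)%E.
Proof. exact: outer_mass_ge0. Qed.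

Let riesz_mass_sigma_additive : semi_sigma_additive riesz_mass.
Proof.
move=> F mF tF mUF; apply: (@caratheodory_measure_sigma_additive R V outer) => //.
- by move=> i; exact: borel_caratheodory.
- exact: borel_caratheodory.
Qed.

HB.instance Definition _ := isMeasure.Build _ (borelRn R n) R riesz_mass
  riesz_mass0 riesz_mass_ge0 riesz_mass_sigma_additive.

Let riesz_mass_finite : fin_num_fun riesz_mass.
Proof. by move=> A _; exact: outer_mass_fin. Qed.

HB.instance Definition _ := Measure_isFinite.Build _ (borelRn R n) R riesz_mass
  riesz_mass_finite.

Definition riesz_measure : {finite_measure set (borelRn R n) -> \bar R} := riesz_mass.

Let B_closed : closed B.
Proof. exact: compact_closed Bc. Qed.

Lemma riesz_measure_open U : open U -> riesz_measure U = lam U.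
Proof. exact: outer_mass_open. Qed.

Lemma riesz_measure_null : riesz_measure (~` B) = 0%E.
Proof.
rewrite riesz_measure_open; last exact: closed_openC.
apply/eqP; rewrite eq_le open_mass_ge0 andbT.
apply: ge_ereal_sup => _ [h [dh _ h0] <-]; rewrite lee_fin -dc_ext0.
by apply: dc_ext_le => //; [exact: dc_cst|move=> x Bx; apply: h0].
Qed.

Lemma riesz_measureT : riesz_measure setT = (L (fun=> 1))%:E.
Proof. by rewrite riesz_measure_open ?open_massT//; exact: openT. Qed.

(** The values of [m h] are cut into layers of height 1: the [k]-th layer lies
    below the indicator of the open set where [k < m h], and a number [t >= 0]
    exceeds at most [t + 1] of the integers [k]. *)
Lemma dc_ext_layers h (N m : nat) : dc h -> (forall x, B x -> 0 <= h x <= N%:R) ->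
  ((L h *+ m)%:E <= \int[riesz_measure]_(y in B) (h y *+ m + 1)%:E)%E.
Proof.
move=> dh hB.
have dhm := dcMn m dh.
pose U k := [set x | k%:R < h x *+ m].
have oU k : open (U k).
  by apply: (open_comp _ (@open_gt _ k%:R)) => x _; exact: dc_continuous.
pose layer k x := Num.min (h x *+ m) k.+1%:R - Num.min (h x *+ m) k%:R.
have dlayer k : dc (layer k) by apply: dcB; apply: dc_min => //; exact: dc_cst.
have ulayer k : below_indicator (U k) (layer k).
  split => // x; rewrite /layer.
    by rewrite -natr1; case: (leP (h x *+ m) k%:R); case: (leP (h x *+ m) (k%:R + 1)); lra.
  move=> /negP; rewrite -leNgt => hk; rewrite (min_idPl hk) min_l ?subrr//.
  by rewrite (le_trans hk)// ler_nat.
have -> : L h *+ m = \sum_(k < N * m) L (layer k).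
  rewrite -dc_extMn// -dc_ext_sum//; apply/eqP; rewrite eq_le.
  have e x : B x -> h x *+ m = \sum_(k < N * m) layer k x.
    move=> /hB /andP[h0 hN]; rewrite sum_unit_layers// mulrn_wge0//=.
    by rewrite -[leLHS]mulr_natr natrM ler_wpM2r.
  by apply/andP; split; apply: dc_ext_le; rewrite //;
    [exact: dc_sum|move=> x /e ->|exact: dc_sum|move=> x /e ->].
have mB : measurable (B : set (borelRn R n)) by exact: closed_borel.
have mU k : measurable (U k : set (borelRn R n)) by exact: open_borel.
rewrite -sumEFin; apply: (@le_trans _ _ (\sum_(k < N * m) riesz_measure (U k))%E).
  by apply: lee_sum => k _; rewrite riesz_measure_open//; exact: open_mass_ub.
have -> : (\sum_(k < N * m) riesz_measure (U k) =
    \int[riesz_measure]_(y in B) (\sum_(k < N * m) (\1_(U k) y)%:E))%E.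
  rewrite ge0_integral_sum//; last first.
    move=> k; apply: (@measurable_funS _ _ _ _ setT) => //.
    by apply/measurable_EFinP; exact: measurable_indic.
  apply: eq_bigr => k _.
  rewrite integral_indic//.
  exact: esym (measure_setI_full mB riesz_measure_null (mU k)).
apply: ge0_le_integral => //.
- by move=> y _; apply: sume_ge0 => k _; rewrite lee_fin.
- apply: emeasurable_sum => k; apply: (@measurable_funS _ _ _ _ setT) => //.
  by apply/measurable_EFinP; exact: measurable_indic.
- apply: (@measurable_funS _ _ _ _ setT) => //.
  apply: continuous_borel => x; apply: (dc_continuous (dcD dhm _)).
  exact: dc_cst.
- move=> y By; rewrite sumEFin lee_fin.
  apply: le_trans (sum_unit_steps (N * m) _); last first.
    by rewrite mulrn_wge0//; case/andP: (hB y By).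
  apply: ler_sum => k _; rewrite indicE.
  by case: (boolP (y \in U k)) => // /[!inE]; rewrite /U/= => ->.
Qed.

Let mB : measurable (B : set (borelRn R n)).
Proof. exact: closed_borel. Qed.

(** Adding a constant makes [h] nonnegative on [B]; the error [1] of the layer
    estimate becomes [1/m] after division by [m]. *)
Lemma dc_ext_le_integral h : dc h -> ((L h)%:E <= \int[riesz_measure]_y (h y)%:E)%E.
Proof.
move=> dh; have [M hM] := continuous_bounded_on Bc (dc_continuous dh).
have mh := continuous_borel (dc_continuous dh).
have hB x : B x -> - M%:R <= h x <= M%:R by move=> /hM; rewrite ler_norml.
have bh : bounded_below_on (B : set (borelRn R n)) (fun y : borelRn R n => (h y)%:E).
  by exists (- M%:R) => y /hB /andP[+ _]; rewrite lee_fin.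
have null := riesz_measure_null.
have cfin (c : R) : (\int[riesz_measure]_(y in setT) c%:E = (c * L (fun=> 1))%:E)%E.
  by rewrite integral_cst// [X in (_ * X)%E]riesz_measureT.
have bc (c : R) : bounded_below_on (B : set (borelRn R n))
  (fun _ : borelRn R n => c%:E) by exists c.
have mc (c : R) : measurable_fun setT (fun _ : borelRn R n => c%:E).
  exact: measurable_cst.
have Ifin : (\int[riesz_measure]_y (h y)%:E)%E \is a fin_num.
  rewrite fin_numElt; apply/andP; split.
    apply: (@lt_le_trans _ _ (\int[riesz_measure]_y (- M%:R)%:E)%E).
      by rewrite cfin ltNyr.
    by apply: (le_integral_bounded_below mB null) => // y /hB /andP[+ _].
  apply: (@le_lt_trans _ _ (\int[riesz_measure]_y (M%:R)%:E)%E).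
    by apply: (le_integral_bounded_below mB null) => // y /hB /andP[_].
  by rewrite cfin ltry.
rewrite -(fineK Ifin) lee_fin; apply: (@le_of_le_harmonic _ _ _ (L (fun=> 1))) => m m0.
have dhM : dc (fun x => h x + M%:R) by apply: dcD dh _; exact: dc_cst.
have := @dc_ext_layers _ (M + M) m dhM.
move=> /(_ _)/wrap[x /hB /andP[h1 h2]|]; first by rewrite natrD; apply/andP; split; lra.
rewrite dc_extD//; last exact: dc_cst.
rewrite -(integral_full_set mB null); last first.
  apply: continuous_borel => x; apply: (dc_continuous (dcD (dcMn m dhM) _)).
  exact: dc_cst.
have -> : L (fun=> M%:R) = M%:R * L (fun=> 1).
  rewrite mulr_natl -dc_extMn; last exact: dc_cst.
  by congr L; apply/funext => x.
under eq_integral => y _.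
  rewrite (_ : _ + 1 = m%:R * h y + (m%:R * M%:R + 1)); last by rewrite -mulr_natr; ring.
  rewrite EFinD EFinM; over.
rewrite (integralD_bounded_below mB null) => //; last 2 first.
- by apply: emeasurable_funM => //; exact: measurable_cst.
- exists (- m%:R * M%:R) => y /hB /andP[h1 _].
  by rewrite -EFinM lee_fin mulNr -mulrN ler_wpM2l.
rewrite (integralZ_bounded_below mB null)// cfin -(fineK Ifin) -EFinM -EFinD lee_fin.
rewrite -[leLHS]mulr_natr => H.
rewrite -(@ler_pM2r _ m%:R) ?ltr0n// mulrDl divfK ?pnatr_eq0 -?lt0n//.
lra.
Qed.

(** The functional and the integral agree, since the inequality between them
    also holds for the opposite function. *)
Lemma riesz_measureE g : cconvex g -> (\int[riesz_measure]_y (g y)%:E = (G g)%:E)%E.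
Proof.
move=> cg; have dg := cconvex_dc cg; have dNg := dcN dg.
have bb h : dc h -> bounded_below_on (B : set (borelRn R n))
    (fun y : borelRn R n => (h y)%:E).
  move=> dh; have [M hM] := continuous_bounded_on Bc (dc_continuous dh).
  by exists (- M%:R) => y /hM; rewrite ler_norml lee_fin => /andP[].
have mf h : dc h -> measurable_fun setT (fun y : borelRn R n => (h y)%:E).
  by move=> dh; exact: continuous_borel (dc_continuous dh).
have : (\int[riesz_measure]_y (g y)%:E + \int[riesz_measure]_y (- g y)%:E = 0)%E.
  rewrite -(integralD_bounded_below mB riesz_measure_null)//; first last.
  - exact: (bb (fun x => - g x)).
  - exact: bb.
  - exact: (mf (fun x => - g x)).
  - exact: mf.
  by under eq_integral do rewrite -EFinD subrr; exact: integral0.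
have := dc_ext_le_integral dg; have := dc_ext_le_integral dNg.
rewrite dc_extN// dc_ext_cconvex//.
move: (\int[_]_y _)%E (\int[_]_y _)%E => [a| |] [b| |] //=.
by rewrite !lee_fin -EFinD => ? ? [?]; congr EFin; lra.
Qed.

End convex_riesz.

Lemma convex_riesz_representation (R : realType) (n : nat) (B : set 'cV[R]_n)
    (G : ('cV[R]_n -> R) -> R) : compact B ->
  (forall g h, cconvex g -> cconvex h -> G (fun x => g x + h x) = G g + G h) ->
  (forall g h, cconvex g -> cconvex h -> (forall x, B x -> g x <= h x) -> G g <= G h) ->
  exists mu : {finite_measure set (borelRn R n) -> \bar R},
    mu (~` B) = 0%E /\
    forall g, cconvex g -> (\int[mu]_y (g y)%:E = (G g)%:E)%E.
Proof.
move=> Bc GD Gle; exists (riesz_measure Bc GD Gle); split.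
  exact: riesz_measure_null.
by move=> g cg; exact: riesz_measureE.
Qed.

(** * Uniqueness of the representing measure *)

Section cconvex_measure_unique.
Context {R : realType} {n : nat}.
Notation V := 'cV[R]_n.
Variables (B : set V).
Hypothesis Bc : compact B.
Notation Bm := (B : set (borelRn R n)).

Let mB : measurable Bm.
Proof. by apply: closed_borel; exact: compact_closed Bc. Qed.

Lemma dc_bounded_below_on h : dc h ->
  bounded_below_on Bm (fun y : borelRn R n => (h y)%:E).
Proof.
move=> dh; have [M hM] := continuous_bounded_on Bc (dc_continuous dh).
by exists (- M%:R) => y /hM; rewrite ler_norml lee_fin => /andP[].
Qed.

Lemma dc_integral_fin (mu : {finite_measure set (borelRn R n) -> \bar R}) h :
  mu (~` B) = 0%E -> dc h -> (\int[mu]_y (h y)%:E)%E \is a fin_num.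
Proof.
move=> muB dh; have [M hM] := continuous_bounded_on Bc (dc_continuous dh).
have hB x : B x -> - M%:R <= h x <= M%:R by move=> /hM; rewrite ler_norml.
have mh := continuous_borel (dc_continuous dh).
have mc (c : R) : measurable_fun setT (fun _ : borelRn R n => c%:E).
  exact: measurable_cst.
have cfin (c : R) : (\int[mu]_(y in setT) c%:E)%E \is a fin_num.
  by rewrite integral_cst// fin_numM// fin_num_measure.
rewrite fin_numElt; apply/andP; split.
  apply: (@lt_le_trans _ _ (\int[mu]_(y in setT) (- M%:R)%:E)%E).
    by rewrite ltNye_eq cfin.
  apply: (le_integral_bounded_below mB muB) => //; first by exists (- M%:R).
  by move=> y /hB /andP[+ _]; rewrite lee_fin.
apply: (@le_lt_trans _ _ (\int[mu]_(y in setT) (M%:R)%:E)%E).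
  apply: (le_integral_bounded_below mB muB) => //; first exact: dc_bounded_below_on.
  by move=> y /hB /andP[_]; rewrite lee_fin.
by rewrite ltey_eq cfin.
Qed.

(** The measure of an open set is the limit of the integrals of bumps, which are
    differences of convex functions. *)
Lemma cconvex_measure_unique (mu nu : {finite_measure set (borelRn R n) -> \bar R}) :
  mu (~` B) = 0%E -> nu (~` B) = 0%E ->
  (forall g, cconvex g -> (\int[mu]_y (g y)%:E = \int[nu]_y (g y)%:E)%E) ->
  forall A : set (borelRn R n), measurable A -> mu A = nu A.
Proof.
move=> muB nuB eqg.
have eqh h : dc h -> (\int[mu]_y (h y)%:E = \int[nu]_y (h y)%:E)%E.
  move=> dh; have [g1 [g2 [c1 c2 hE]]] := dh.
  have I (m : {finite_measure set (borelRn R n) -> \bar R}) : m (~` B) = 0%E ->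
      (\int[m]_y (h y)%:E + \int[m]_y (g2 y)%:E = \int[m]_y (g1 y)%:E)%E.
    move=> mB0; rewrite -(integralD_bounded_below mB mB0).
    - by apply: eq_integral => y _; rewrite -EFinD hE subrK.
    - exact: continuous_borel (dc_continuous dh).
    - exact: continuous_borel (proj1 c2).
    - exact: dc_bounded_below_on.
    - exact/dc_bounded_below_on/cconvex_dc.
  have := I mu muB; rewrite (eqg _ c2) (eqg _ c1) -(I nu nuB).
  move: (dc_integral_fin nuB (cconvex_dc c2)).
  move: (dc_integral_fin nuB dh) (dc_integral_fin muB dh).
  move: (\int[mu]_y (h y)%:E)%E (\int[nu]_y (h y)%:E)%E (\int[nu]_y (g2 y)%:E)%E.
  move=> [a| |] [b| |] [c| |] //= _ _ _; rewrite -!EFinD => -[ab].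
  by congr EFin; lra.
have openU (U : set V) : open U -> mu U = nu U.
  move=> oU; have [D [dD D0 DU DnU]] := open_dc_distance oU.
  pose bump k x := Num.min 1 (D x *+ k).
  have dbump k : dc (bump k) by apply: dc_min; [exact: dc_cst|exact: dcMn].
  have cvgU (m : {finite_measure set (borelRn R n) -> \bar R}) :
      (\int[m]_y (bump k y)%:E)%E @[k --> \oo] --> m U.
    have limE y : limn (fun k => (bump k y)%:E) = (\1_U y)%:E.
      apply: cvg_lim => //; rewrite indicE.
      have [Uy|nUy] := pselect (U y); last first.
        rewrite memNset// (_ : (fun k => _) = fun=> 0%:E); first exact: cvg_cst.
        by apply/funext => k; rewrite /bump DnU// mul0rn min_r.
      rewrite mem_set//.
      apply: cvg_near_cst; near=> k; rewrite /bump min_l//.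
      rewrite -mulr_natr -ler_pdivrMl ?DU// mulr1.
      by near: k; exact: nbhs_infty_ger.
    have := @cvg_monotone_convergence _ (borelRn R n) R m setT measurableT
      (fun k y => (bump k y)%:E).
    under [X in _ --> X]eq_integral do rewrite limE.
    rewrite integral_indic ?setIT//; last exact: open_borel.
    apply.
    - by move=> k; exact: continuous_borel (dc_continuous (dbump k)).
    - by move=> k y _; rewrite lee_fin le_min ler01 mulrn_wge0.
    - move=> y _ k l kl; rewrite lee_fin /bump le_min !ge_min lexx/=.
      by rewrite ler_wpMn2l ?orbT.
  have := cvgU mu; under eq_fun do rewrite eqh//.
  by move=> /cvg_lim <-//; exact/cvg_lim.
apply: (@measure_unique _ _ (borelRn R n) (@open V) (fun=> setT)) => //.
- by move=> U W; exact: openI.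
- by move=> _; exact: openT.
- by rewrite bigcup_const//; exists 0%N.
- by move=> _; rewrite ltey_eq fin_num_measure.
Unshelve. all: by end_near. Qed.

End cconvex_measure_unique.

(** * Approximation from below by finite convex functions *)

Section inf_convolution.
Context {R : realType} {n : nat}.
Notation V := 'cV[R]_n.

(** The inf-convolutions of [f] with multiples of the norm, of slopes larger than
    the constant [C] of a bound [c - C `|x| <= f x], which makes them finite. The
    infimum runs over points [(y, r)] of the epigraph of [f] in order to stay
    within the real numbers. Lower semicontinuity makes them increase to [f]. *)
Lemma is_Conv0_approximation (f : V -> \bar R) : is_Conv0 f ->
  exists g : nat -> V -> R,
    [/\ forall k, cconvex (g k), forall k x, g k x <= g k.+1 x,
        forall k x, ((g k x)%:E <= f x)%E &
        forall x (a : R), (a%:E < f x)%E -> exists k, a < g k x].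
Proof.
move=> f0; have [_ [C [_ C0 fC _]]] := is_Conv0_lipschitz_at0 f0.
have f0E := fineK (is_Conv0_fin0 f0); set c := fine (f 0) in f0E fC.
have [fNy _ lf cf] : is_Conv f by case: f0.
pose S k x := [set s | exists (y : V) (r : R),
  (f y <= r%:E)%E /\ s = r + (C + k%:R) * `|x - y|].
have Slb k x s : S k x s -> c - C * `|x| <= s.
  move=> [y [r [fy ->]]].
  have : c - C * `|y| <= r by rewrite -lee_fin (le_trans (fC y)).
  have : C * `|y| <= C * (`|x| + `|x - y|).
    by rewrite ler_wpM2l// -[X in `|X|](subKr x) (le_trans (ler_normB _ _)).
  have : 0 <= k%:R * `|x - y| by rewrite mulr_ge0.
  by lra.
have Slbd k x : has_lbound (S k x) by exists (c - C * `|x|) => s; exact: Slb.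
have S0 k x : S k x !=set0.
  by exists (c + (C + k%:R) * `|x - 0|), 0, c; rewrite f0E.
pose g k x := inf (S k x).
have gle k x y (r : R) : (f y <= r%:E)%E -> g k x <= r + (C + k%:R) * `|x - y|.
  by move=> fy; apply: ge_inf => //; exists y, r.
have gge k x b : (forall y (r : R), (f y <= r%:E)%E ->
    b <= r + (C + k%:R) * `|x - y|) -> b <= g k x.
  by move=> H; apply: lb_le_inf => // _ [y [r [fy ->]]]; exact: H.
have Ck k : 0 <= C + k%:R by rewrite addr_ge0.
exists g; split.
- move=> k; have gc : real_convex (g k).
    move=> x1 x2 t t01; apply/ler_addgt0Pr => e e0.
    have [_ [y1 [r1 [fy1 ->]]] h1] := inf_adherent e0 (conj (S0 k x1) (Slbd k x1)).
    have [_ [y2 [r2 [fy2 ->]]] h2] := inf_adherent e0 (conj (S0 k x2) (Slbd k x2)).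
    apply: le_trans (gle k _ _ _ (econvex_le cf t01 fy1 fy2)) _.
    have /andP[t0 t1] := t01; have t1' : 0 <= 1 - t by rewrite subr_ge0.
    have -> : t *: x1 + (1 - t) *: x2 - (t *: y1 + (1 - t) *: y2) =
        t *: (x1 - y1) + (1 - t) *: (x2 - y2).
      by apply/matrixP => i j; rewrite !mxE; ring.
    have := ler_normD (t *: (x1 - y1)) ((1 - t) *: (x2 - y2)).
    rewrite !normrZ !ger0_norm// => /(ler_wpM2l (Ck k)).
    have := ler_wpM2l t0 (ltW h1); have := ler_wpM2l t1' (ltW h2).
    rewrite -/(g k x1) -/(g k x2); lra.
  split => //; apply: real_convex_continuous => // z.
  exists 1, (c + (C + k%:R) * (`|z| + 1)); split => // w wz.
  apply: le_trans (gle k w 0 c _) _; first by rewrite f0E.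
  rewrite subr0 lerD2l ler_wpM2l// -[w](subrK z) addrC.
  by rewrite (le_trans (ler_normD _ _))// lerD2l.
- move=> k x; apply: gge => y r fy; apply: le_trans (gle k x y r fy) _.
  by rewrite lerD2l ler_wpM2r// lerD2l ler_nat.
- move=> k x; have := fNy x; case fx : (f x) => [r| |] // _; last exact: leey.
  rewrite lee_fin; have := gle k x x r; rewrite subrr normr0 mulr0 addr0; apply.
  by rewrite fx.
- move=> x a /lt_fin_between[b ab /lf[U /nbhs_normP[d /= d0 dU] Ub]].
  pose k := (Num.truncn ((b - (c - C * `|x|)) / d)).+1.
  exists k; apply: lt_le_trans ab _; apply: gge => y r fy.
  have [xyd|dxy] := ltP `|x - y| d.
    have : b <= r by rewrite -lee_fin (le_trans (ltW (Ub y _)))//; exact: dU.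
    have : 0 <= (C + k%:R) * `|x - y| by rewrite mulr_ge0.
    by lra.
  have : (b - (c - C * `|x|)) / d < k%:R by exact: truncnS_gt.
  rewrite ltr_pdivrMr// => kd.
  have : c - C * `|x| <= r + (C + 0%:R) * `|x - y| by apply: (Slb 0%N); exists y, r.
  have : k%:R * d <= k%:R * `|x - y| by rewrite ler_wpM2l.
  by lra.
Qed.

Lemma epi_cvg_nondecreasing (g : nat -> V -> R) (f : V -> \bar R) :
  (forall k, continuous (g k)) -> (forall k x, g k x <= g k.+1 x) ->
  (forall k x, ((g k x)%:E <= f x)%E) ->
  (forall x (a : R), (a%:E < f x)%E -> exists k, a < g k x) ->
  epi_cvg (fun k x => (g k x)%:E) f.
Proof.
move=> gc gS gf fg.
have gle k l x : (k <= l)%N -> g k x <= g l x.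
  by move=> kl; apply: (homo_leq (f := fun i => g i x) le_refl le_trans).
move=> x; split=> [xs xsx|].
  apply: limn_einf_ge => a /fg[k agk].
  have : \forall j \near \oo, a < g k (xs j).
    by apply: (cvgr_gt (g k x)) => //; exact: (cvg_comp _ _ xsx (gc k x)).
  move=> H; near=> j; rewrite lee_fin; apply: (@le_trans _ _ (g k (xs j))).
    by apply/ltW; near: j.
  by apply: gle; near: j; exact: nbhs_infty_ge.
exists (fun=> x); first exact: cvg_cst.
apply: cvge_of_bounds => [a /fg[k agk]|b fb].
  near=> j; rewrite lee_fin (le_trans (ltW agk))// gle//.
  by near: j; exact: nbhs_infty_ge.
by apply: nearW => j; apply: le_trans (gf j x) (ltW fb).
Unshelve. all: by end_near. Qed.

End inf_convolution.

(** * Rotations and the Euclidean norm *)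

Section rotations.
Context {R : realType} {n : nat}.
Notation V := 'cV[R]_n.
Implicit Types (x y : V) (eta : 'M[R]_n).

Lemma enormE x : enorm x = Num.sqrt ((x^T *m x) 0 0).
Proof.
by rewrite /enorm mxE; congr Num.sqrt; apply: eq_bigr => i _; rewrite !mxE expr2.
Qed.

Lemma enorm_ge0 x : 0 <= enorm x. Proof. exact: sqrtr_ge0. Qed.

Lemma enormZ (t : R) x : 0 <= t -> enorm (t *: x) = t * enorm x.
Proof.
move=> t0; rewrite /enorm; under eq_bigr do rewrite mxE exprMn.
by rewrite -mulr_sumr sqrtrM ?sqr_ge0// sqrtr_sqr ger0_norm.
Qed.

Lemma enorm0 : enorm (0 : V) = 0.
Proof. by rewrite -(scale0r (0 : V)) enormZ// mul0r. Qed.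

Lemma enorm_gt0 x : x != 0 -> 0 < enorm x.
Proof.
move=> x0; rewrite sqrtr_gt0 lt_neqAle sumr_ge0 ?andbT => [|i _]; last exact: sqr_ge0.
rewrite eq_sym psumr_neq0 => [|i _]; last exact: sqr_ge0.
apply/hasP; apply: contrapT => h; move/eqP: x0; apply.
apply/matrixP => i j; rewrite ord1 mxE; apply: contrapT => /eqP xi.
by apply: h; exists i; rewrite ?mem_index_enum//= exprn_even_gt0.
Qed.

Lemma SO_mulmx eta1 eta2 : SO eta1 -> SO eta2 -> SO (eta1 *m eta2).
Proof.
move=> [h1 d1] [h2 d2]; split; last by rewrite det_mulmx d1 d2 mulr1.
by rewrite trmx_mul mulmxA -(mulmxA eta1) h2 mulmx1.
Qed.

Lemma SO_trmxV eta : SO eta -> eta^T *m eta = 1%:M.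
Proof. by case=> /mulmx1C. Qed.

Lemma SO_trmx eta : SO eta -> SO eta^T.
Proof. by move=> so; split; [rewrite trmxK SO_trmxV|rewrite det_tr; case: so]. Qed.

Lemma SO_invmx eta : SO eta -> invmx eta = eta^T.
Proof.
move=> so; have u : eta \in unitmx by rewrite unitmxE; case: so => _ ->; rewrite unitr1.
by rewrite -[LHS]mul1mx -(SO_trmxV so) -mulmxA mulmxV// mulmx1.
Qed.

Lemma enorm_SO eta x : SO eta -> enorm (eta *m x) = enorm x.
Proof.
by move=> so; rewrite !enormE trmx_mul mulmxA -(mulmxA x^T) SO_trmxV// mulmx1.
Qed.

Lemma SO_coord_le1 eta i k : SO eta -> `|eta i k| <= 1.
Proof.
case=> /matrixP/(_ i i) o _; rewrite !mxE eqxx mulr1n in o.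
rewrite -(@ler_pXn2r _ 2)// ?nnegrE// expr1n real_normK ?num_real// -o.
rewrite (bigD1 k)//= !mxE -expr2 lerDl sumr_ge0// => j _.
by rewrite mxE -expr2 sqr_ge0.
Qed.

Lemma mulmx_norm_le (A : 'M[R]_n) (a : R) x : 0 <= a ->
  (forall i k, `|A i k| <= a) -> `|A *m x| <= n%:R * a * `|x|.
Proof.
move=> a0 Aa; apply: mx_norm_le => [|i j]; first by rewrite !mulr_ge0.
rewrite mxE (le_trans (ler_norm_sum _ _ _))//.
apply: (@le_trans _ _ (\sum_(k < n) a * `|x|)).
  apply: ler_sum => k _; rewrite normrM ler_pM ?Aa//; exact: mx_coord_le_norm.
by rewrite sumr_const card_ord -[leLHS]mulr_natl mulrA.
Qed.

Lemma enorm_le x : enorm x <= n%:R * `|x|.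
Proof.
rewrite -[leRHS]ger0_norm ?mulr_ge0// -sqrtr_sqr ler_wsqrtr//.
apply: (@le_trans _ _ (\sum_(k < n) `|x| ^+ 2)).
  apply: ler_sum => k _; rewrite -real_normK ?num_real//.
  by rewrite ler_pXn2r ?nnegrE// mx_coord_le_norm.
rewrite sumr_const card_ord -[leLHS]mulr_natl exprMn ler_wpM2r ?sqr_ge0//.
by rewrite -natrX ler_nat; case: (n) => // m; rewrite leq_pmulr.
Qed.

Lemma mulmx_bounded_on (A : 'M[R]_n) (r : R) :
  exists r' : R, 0 <= r' /\ forall x, `|x| <= r -> `|A *m x| <= r'.
Proof.
have [r0|r0] := leP 0 r; last first.
  by exists 0; split => // x /le_lt_trans/(_ r0); rewrite ltNge normr_ge0.
exists (n%:R * `|A| * r); split; first by rewrite !mulr_ge0.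
move=> x xr; apply: le_trans (@mulmx_norm_le A `|A| x _ _) _ => //.
  exact: mx_coord_le_norm.
by rewrite ler_wpM2l// mulr_ge0.
Qed.

End rotations.

(** * The support of a finite measure *)

Section support.
Context {R : realType} {n : nat}.
Notation V := 'cV[R]_n.
Variable mu : {finite_measure set (borelRn R n) -> \bar R}.

Lemma measure_support_closed : closed (measure_support mu).
Proof.
rewrite -openC openE => x /= /existsNP[U] /not_implyP[[oU Ux] /negP].
rewrite -leNgt => U0; rewrite /interior /=.
apply: filterS (open_nbhs_nbhs (conj oU Ux)) => y Uy sy.
by have := sy U (conj oU Uy); rewrite ltNge U0.
Qed.

Lemma measure_support_sub (B : set V) : closed B -> mu (~` B) = 0%E ->
  measure_support mu `<=` B.
Proof.
move=> cB B0 x sx; apply: contrapT => nBx.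
have := sx (~` B) (conj (closed_openC cB) nBx).
by rewrite [X in (_ < X)%E](_ : _ = 0%E) ?ltxx.
Qed.

(** The complement of the support is a countable union of compact sets, each of
    which is covered by finitely many null open sets. *)
Lemma measure_support_null : mu (~` measure_support mu) = 0%E.
Proof.
set W := ~` _; have oW : open W by exact/closed_openC/measure_support_closed.
have [D [dD D0 DW DnW]] := open_dc_distance oW.
pose E k : set V := [set x | `|x| <= k%:R] `&` [set x | k.+1%:R^-1 <= D x].
have cE k : compact (E k).
  apply: compact_closedI; first exact: cV_closed_ball_compact.
  exact: (closed_comp (fun u _ => @dc_continuous _ _ _ dD u) (@closed_ge _ _)).
have EW k : E k `<=` W.
  move=> x [_ /= Dx]; apply: contrapT => /DnW D0'.
  by move: Dx; rewrite D0' leNgt invr_gt0 ltr0n.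
have mE k : measurable (E k : set (borelRn R n)).
  by apply: closed_borel; exact: compact_closed (cE k).
have null k : mu (E k) = 0%E.
  (* near the filter of the sets containing a null set, the covering property
     of compact sets yields one null set containing E k *)
  pose F := [set P : set (set V) | exists N0 : set (borelRn R n),
    [/\ measurable N0, mu N0 = 0%E & forall N, N0 `<=` N -> P N]].
  have FF : Filter F.
    split.
    - by exists set0; split => //; exact: measure0.
    - move=> P Q [N1 [m1 z1 h1]] [N2 [m2 z2 h2]]; exists (N1 `|` N2); split.
      + exact: measurableU.
      + apply/eqP; rewrite eq_le measure_ge0 andbT -(adde0 0%E).
        by rewrite -[X in (_ <= X + _)%E]z1 -[X in (_ <= _ + X)%E]z2 measureU2.
      + by move=> N; rewrite subUset => -[N1N N2N]; split; [exact: h1|exact: h2].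
    - by move=> P Q PQ [N0 [m0 z0 h0]]; exists N0; split => // N /h0 /PQ.
  have /compact_near_coveringP/(_ _ F (fun N x => N x)) := cE k.
  move=> [] // => [x /EW /existsNP[U] /not_implyP[[oU Ux] /negP]|N0 [m0 z0 h0]].
    rewrite -leNgt => U0; exists (U, [set N | U `<=` N]).
      split => /=; first exact: open_nbhs_nbhs.
      exists U; split => //; first exact: open_borel.
      by apply/eqP; rewrite eq_le U0/=; exact: measure_ge0.
    by move=> [y N] [/= Uy UN]; exact: UN.
  apply/eqP; rewrite eq_le measure_ge0 andbT -[leRHS]z0.
  by apply: le_measure; rewrite ?inE//; exact: (h0 N0).
have -> : W = \bigcup_k E k.
  apply/seteqP; split=> [x Wx|x [k _ /EW]//].
  pose k := maxn (Num.truncn `|x|).+1 (Num.truncn (D x)^-1).+1.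
  exists k => //; split => /=.
    by apply/ltW/(lt_le_trans (truncnS_gt _)); rewrite ler_nat leq_maxl.
  rewrite invf_ple ?posrE ?ltr0n ?DW//.
  apply/ltW/(lt_le_trans (truncnS_gt _)); rewrite ler_nat.
  exact: leq_trans (leq_maxr _ _) (leqnSn _).
apply/negligibleP; first by apply: bigcup_measurable => k _; exact: mE.
by apply: negligible_bigcup => k; apply/negligibleP => //; exact: null.
Qed.

End support.

(** * Integrals of epi-convergent sequences *)

Section convex_integrals.
Context {R : realType} {n : nat}.
Notation V := 'cV[R]_n.
Implicit Types (f : V -> \bar R) (A : 'M[R]_n).

Lemma compact_norm_le (K : set V) : compact K -> exists2 r : R, 0 <= r &
  forall y, K y -> `|y| <= r.
Proof.
move=> /compact_bounded[M [_ MK]]; exists (Num.truncn M).+1%:R => // y Ky.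
by apply: MK Ky; exact: truncnS_gt.
Qed.

Lemma is_Conv0_mulmx_measurable f A : is_Conv0 f ->
  measurable_fun setT (fun y : borelRn R n => f (A *m (y : V))).
Proof.
move=> /(is_Conv0_comp_mulmx A) [[_ _ lf _] _].
exact: lower_semicontinuous_borel.
Qed.

Lemma is_Conv0_bounded_below_on f A (K : set V) : compact K -> is_Conv0 f ->
  bounded_below_on (K : set (borelRn R n)) (fun y : borelRn R n => f (A *m (y : V))).
Proof.
move=> /compact_norm_le[r r0 Kr] f0.
have [_ [C [_ C0 fC _]]] := is_Conv0_lipschitz_at0 f0.
have [r' [r'0 Ar]] := mulmx_bounded_on A r.
exists (fine (f 0) - C * r') => y /Kr /Ar Ay; apply: le_trans (fC _).
by rewrite lee_fin lerD2l lerN2 ler_wpM2l.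
Qed.

(** The values at 0 are eventually bounded below, and convexity together with the
    uniform upper bound near 0 propagates this to bounded sets. *)
Lemma epi_cvg_bounded_below fs f (r : R) : epi_cvg fs f ->
  (forall j, is_Conv0 (fs j)) -> is_Conv0 f ->
  exists m : R, \forall j \near \oo, forall z, `|z| <= r -> (m%:E <= fs j z)%E.
Proof.
move=> fsf fsC fC.
have [d [M [d0 fM]]] := epi_cvg_bounded_near0 fsf fsC fC.
pose c := fine (f 0) - 1.
have cf : (c%:E < f 0%R)%E.
  by rewrite -(fineK (is_Conv0_fin0 fC)) lte_fin ltrBlDr ltrDl.
have nc := epi_cvg_liminf fsf (cvg_cst (0 : V)) cf.
exists (c - `|r| / d * (M - c)); near=> j => z zr.
have cj : (c%:E <= fs j 0%R)%E by apply/ltW; near: j; exact: nc.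
have Mj w : `|w - 0| <= d -> (fs j w <= M%:E)%E.
  by rewrite subr0; move: w; near: j; exact: fM.
have cM : c <= M.
  by rewrite -lee_fin (le_trans cj)// Mj// subr0 normr0 ltW.
have [[_ _ _ cvj] _] := fsC j.
apply: le_trans (econvex_lower_bound cvj d0 Mj cj z).
rewrite lee_fin lerD2l lerN2 subr0 ler_wpM2r ?subr_ge0//.
rewrite ler_wpM2r ?invr_ge0 ?(ltW d0)//.
exact: le_trans zr (ler_norm r).
Unshelve. all: by end_near. Qed.

Variable mu : {finite_measure set (borelRn R n) -> \bar R}.
Hypothesis muc : compactly_supported mu.
Notation K := (measure_support mu).

Let mK : measurable (K : set (borelRn R n)).
Proof. by apply: closed_borel; exact: measure_support_closed. Qed.

Let muK := measure_support_null mu.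

Variables (fs : nat -> V -> \bar R) (f : V -> \bar R).
Hypotheses (fsf : epi_cvg fs f) (fsC : forall j, is_Conv0 (fs j)) (fC : is_Conv0 f).

Lemma epi_integral_lower A (a : R) : (a%:E < \int[mu]_y f (A *m (y : V)))%E ->
  \forall j \near \oo, (a%:E < \int[mu]_y fs j (A *m (y : V)))%E.
Proof.
apply: limn_einf_gt; have [r _ Kr] := compact_norm_le muc.
have [r' [_ Ar]] := mulmx_bounded_on A r.
have [m fm] := epi_cvg_bounded_below r' fsf fsC fC.
apply: (fatou_bounded_below mK muK (M := m)).
- exact: is_Conv0_mulmx_measurable.
- by move=> j; exact: is_Conv0_mulmx_measurable.
- exact: is_Conv0_bounded_below_on.
- by apply: filterS fm => j fm y /Kr /Ar /fm.
- move=> y b _ bf; apply: filterS (epi_cvg_liminf fsf (cvg_cst (A *m y)) bf).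
  by move=> j /ltW.
Qed.

(** The point [z] lies on the segment from [p] to a point of the ball of radius
    [d], at ratio [t]. *)
Lemma econvex_fill (g : V -> \bar R) (t d a M : R) (p z : V) : econvex g ->
  0 < t < 1 -> (forall w, `|w| <= d -> (g w <= M%:E)%E) -> (g p <= a%:E)%E ->
  `|z - t *: p| <= (1 - t) * d -> (g z <= (t * a + (1 - t) * M)%:E)%E.
Proof.
move=> cg /andP[t0 t1] gM gp zp; have t1' : 0 < 1 - t by rewrite subr_gt0.
have gw : (g ((1 - t)^-1 *: (z - t *: p)) <= M%:E)%E.
  apply: gM; rewrite normrZ ger0_norm ?invr_ge0 ?(ltW t1')//.
  by rewrite ler_pdivrMl.
have t01 : 0 <= t <= 1 by rewrite !ltW.
have := econvex_le cg t01 gp gw; rewrite scalerA divff ?gt_eqF// scale1r.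
by rewrite addrC subrK.
Qed.

(** At [t *: A *m y] the functions are dominated by convexity between recovery
    sequences at points of the effective domain of [f], which meets every
    neighborhood of [A *m y] because [y] lies in the support, and a uniform
    bound near [0]. *)
Lemma epi_cvg_bounded_above A (t : R) : (\int[mu]_y f (A *m (y : V)) < +oo)%E ->
  0 < t < 1 ->
  exists M : R, \forall j \near \oo, forall y, K y -> (fs j (t *: (A *m y)) <= M%:E)%E.
Proof.
move=> fA t01; have /andP[t0 t1] := t01; have t1' : 0 < 1 - t by rewrite subr_gt0.
have [d [M0 [d0 fM]]] := epi_cvg_bounded_near0 fsf fsC fC.
(* a third for each of the distances from A *m y to the point A *m y' to be
   bounded, to A *m y2 in the domain of f, and from the latter to xs j *)
pose rho := (1 - t) * d / 3.
have rho0 : 0 < rho by rewrite divr_gt0// mulr_gt0.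
suff : \forall Mj \near (pinfty_nbhs R, \oo),
    K `<=` [set y | (fs Mj.2 (t *: (A *m y))%R <= Mj.1%:E)%E].
  case=> -[/= X Y] [Xoo Yoo] XY; have [M XM] := filter_ex Xoo.
  by exists M; apply: filterS Yoo => j Yj; exact: (XY (M, j) (conj XM Yj)).
have /compact_near_coveringP := muc.
move=> /(_ _ (filter_prod (pinfty_nbhs R) \oo)
  (fun Mj y => (fs Mj.2 (t *: (A *m y))%R <= Mj.1%:E)%E)).
apply => y Ky.
have Ay : nbhs y [set y' | `|A *m y - A *m y'| <= rho].
  apply: (@cvgr_dist_le _ _ _ (nbhs y) (nbhs_filter y) (mulmx A)) => //.
  exact: mulmx_continuous.
have [U [oU Uy] UA] : exists2 U, open_nbhs y U & U `<=` [set y' | `|A *m y - A *m y'| <= rho].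
  by move: Ay; rewrite nbhsE => -[U oU UA]; exists U.
have [y2 Uy2 fy2] : exists2 y2, U y2 & (f (A *m y2) < +oo)%E.
  have := Ky U (conj oU Uy); apply: (integral_lty_exists mK muK _ _ fA).
  - exact: is_Conv0_mulmx_measurable.
  - exact: is_Conv0_bounded_below_on.
  - exact: open_borel.
have [a fa] : exists a : R, (f (A *m y2) < a%:E)%E.
  have := fy2; have [[fNy _ _ _] _] := fC; have := fNy (A *m y2).
  by case: (f _) => [s| |] // _ _; exists (s + 1); rewrite lte_fin ltrDl.
have [xs xsA fxs] := (fsf (A *m y2)).2.
have n1 : \forall j \near \oo, (fs j (xs j) < a%:E)%E.
  exact: (fxs _ (open_ereal_lt' fa)).
have n2 : \forall j \near \oo, `|A *m y2 - xs j| <= rho.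
  exact: cvgr_dist_le _ _ xsA _ rho0.
pose Q j := [/\ (fs j (xs j) < a%:E)%E, `|A *m y2 - xs j| <= rho &
  forall w, `|w| <= d -> (fs j w <= M0%:E)%E].
exists ([set y' | `|A *m y - A *m y'| <= rho],
    [set Mj | t * a + (1 - t) * M0 <= Mj.1 /\ Q Mj.2]).
  split => //=; exists ([set M' | t * a + (1 - t) * M0 <= M'], [set j | Q j]).
    split => /=; first by apply: nbhs_pinfty_ge; exact: num_real.
    by apply: filterS3 n1 n2 fM => j; split.
  by move=> [M' j] [].
move=> [y' [M' j]] /= [yy' [MM' [fx xA fw]]].
apply: (@le_trans _ _ (t * a + (1 - t) * M0)%:E); last by rewrite lee_fin.
have [[_ _ _ cj] _] := fsC j.
apply: (econvex_fill cj t01 fw (ltW fx)).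
rewrite -scalerBr normrZ gtr0_norm//.
apply: (@le_trans _ _ `|A *m y' - xs j|); first by rewrite ler_piMl// ltW.
have -> : A *m y' - xs j =
    (A *m y2 - xs j) + ((A *m y - A *m y2) - (A *m y - A *m y')).
  by apply/matrixP => i k; rewrite !mxE; ring.
apply: le_trans (ler_normD _ _) _.
have := ler_normB (A *m y - A *m y2) (A *m y - A *m y').
have /= := UA _ Uy2; move: yy' xA; rewrite /rho; lra.
Qed.

(** Fatou's lemma applied to the opposite functions. At a point [y] with
    [f (A *m y)] finite, convexity between a recovery sequence at [A *m y] and
    points tending to 0 bounds the upper limit of [fs j (t *: (A *m y))] by
    [t * f (A *m y) + (1 - t) * M0]. *)
Lemma epi_integral_upper : exists M : R, forall A (r t e : R),
  (\int[mu]_y f (A *m (y : V)) <= r%:E)%E -> 0 < t < 1 -> 0 < e ->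
  \forall j \near \oo,
    (\int[mu]_y fs j (t *: (A *m (y : V)))%R <= (t * r + (1 - t) * M + e)%:E)%E.
Proof.
have [d [M0 [d0 fM]]] := epi_cvg_bounded_near0 fsf fsC fC.
have muTE : mu setT = (fine (mu setT))%:E by rewrite fineK// fin_num_measure.
exists (M0 * fine (mu setT)) => A r t e fr t01 e0.
have /andP[t0 t1] := t01; have t1' : 0 < 1 - t by rewrite subr_gt0.
have flty : (\int[mu]_y f (A *m (y : V)) < +oo)%E by rewrite (le_lt_trans fr)// ltry.
have [M2 fM2] := epi_cvg_bounded_above flty t01.
have [r0 _ Kr] := compact_norm_le muc.
have [r1 [_ Ar]] := mulmx_bounded_on A r0.
have [m fm] := epi_cvg_bounded_below r1 fsf fsC fC.
have Kr1 y : K y -> `|t *: (A *m y)| <= r1.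
  move=> /Kr /Ar Ay; rewrite normrZ gtr0_norm//.
  by rewrite (le_trans _ Ay)// ler_piMl// ltW.
pose us j (y : borelRn R n) := fs j (t *: (A *m (y : V))).
have mus j : measurable_fun setT (us j).
  rewrite /us; under eq_fun do rewrite scalemxAl.
  exact: is_Conv0_mulmx_measurable.
pose fA (y : borelRn R n) := f (A *m (y : V)).
have mf : measurable_fun setT fA by exact: is_Conv0_mulmx_measurable.
have bf : bounded_below_on (K : set (borelRn R n)) fA.
  exact: is_Conv0_bounded_below_on.
pose w (y : borelRn R n) := (t%:E * fA y + ((1 - t) * M0)%:E)%E.
have mt : measurable_fun setT (fun y : borelRn R n => (t%:E * fA y)%E).
  by apply: emeasurable_funM => //; exact: measurable_cst.
have bt : bounded_below_on (K : set (borelRn R n)) (fun y => t%:E * fA y)%E.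
  have [b fb] := bf; exists (t * b) => y /fb.
  by rewrite EFinM => h; apply: lee_wpmul2l => //; rewrite lee_fin ltW.
have mc (c : R) : measurable_fun setT (fun _ : borelRn R n => c%:E).
  exact: measurable_cst.
have mw : measurable_fun setT w by apply: emeasurable_funD => //; exact: mc.
(* w is infinite where f is, so it is truncated at the uniform bound M2 *)
pose v y := mine (w y) M2%:E.
have mv : measurable_fun setT v by apply: measurable_mine => //; exact: mc.
have [b vb] : bounded_below_on (K : set (borelRn R n)) v.
  have [b fb] := bt; exists (Num.min (b + (1 - t) * M0) M2) => y /fb by_.
  rewrite /v EFin_min le_min !ge_min lexx orbT andbT.
  by rewrite /w EFinD leeD2r.
have vM2 y : (v y <= M2%:E)%E by rewrite /v ge_min lexx orbT.
have Iv : (\int[mu]_y v y <= (t * r + (1 - t) * (M0 * fine (mu setT)))%:E)%E.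
  apply: (@le_trans _ _ (\int[mu]_y w y)%E).
    apply: (le_integral_bounded_below mK muK) => //; first by exists b.
    by move=> y _; rewrite /v ge_min lexx.
  rewrite (integralD_bounded_below mK muK) => //; last by exists ((1 - t) * M0).
  rewrite (integralZ_bounded_below mK muK (ltW t0))// integral_cst//.
  rewrite (_ : (_ * mu _)%E = ((1 - t) * (M0 * fine (mu setT)))%:E); last first.
    by rewrite [X in (_ * X)%E]muTE -EFinM mulrA.
  rewrite EFinD; apply: leeD2r; rewrite EFinM.
  by apply: lee_wpmul2l => //; rewrite lee_fin ltW.
have NvE : (\int[mu]_y (- v y) = - \int[mu]_y v y)%E.
  apply: (integralN_bounded mK muK (m := b) (M := M2)) => //.
  by move=> y /vb ->; rewrite vM2.
have fat : (\int[mu]_y (- v y) <= limn_einf (fun j => \int[mu]_y (- us j y)))%E.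
  apply: (fatou_bounded_below mK muK (M := - M2)).
  - exact: measurableT_comp.
  - by move=> j; exact: measurableT_comp.
  - by exists (- M2) => y _; rewrite EFinN leeN2.
  - apply: filterS fM2 => j fM2 y Ky; rewrite EFinN leeN2; exact: fM2.
  - move=> y a Ky; rewrite lteNr -EFinN /v gt_min => /orP[wa|M2a]; last first.
      apply: filterS fM2 => j fM2; rewrite leeNr -EFinN (le_trans (fM2 y Ky))//.
      exact: ltW.
    have [s fs_ sa] : exists2 s : R, (fA y < s%:E)%E & t * s + (1 - t) * M0 <= - a.
      move: wa; rewrite /w; have [b0 /(_ y Ky)] := bf.
      case: (fA y) => [s| |] //= _; last by rewrite gt0_muley ?lte_fin// addye// ltNge leey.
      rewrite -?EFinM -?EFinD lte_fin => sa.
      exists ((- a - (1 - t) * M0) / t).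
        by rewrite lte_fin ltr_pdivlMr// ltrBrDr mulrC.
      by rewrite mulrC divfK ?gt_eqF// subrK.
    have [xs xsA fxs] := (fsf (A *m y)).2.
    have n1 : \forall j \near \oo, (fs j (xs j) < s%:E)%E.
      exact: (fxs _ (open_ereal_lt' fs_)).
    have dt0 : 0 < (1 - t) * d by rewrite mulr_gt0.
    have n2 : \forall j \near \oo, `|A *m y - xs j| <= (1 - t) * d.
      exact: cvgr_dist_le _ _ xsA _ dt0.
    apply: filterS3 n1 n2 fM => j fsj xsj fMj; rewrite leeNr -EFinN.
    apply: (@le_trans _ _ (t * s + (1 - t) * M0)%:E); last by rewrite lee_fin.
    have [[_ _ _ cj] _] := fsC j.
    apply: (econvex_fill cj t01 fMj (ltW fsj)).
    rewrite -scalerBr normrZ gtr0_norm//.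
    by rewrite (le_trans _ xsj)// ler_piMl// ltW.
have al : ((- (t * r + (1 - t) * (M0 * fine (mu setT)) + e))%:E < \int[mu]_y (- v y))%E.
  rewrite NvE lteNr EFinN oppeK (le_lt_trans Iv)// lte_fin ltrDl//.
have := limn_einf_gt fat al; apply: filterS3 fm fM2 => j fmj fM2j.
rewrite (integralN_bounded mK muK (m := m) (M := M2))//.
  by rewrite EFinN lteN2 => /ltW.
by move=> y Ky; rewrite fmj ?Kr1// fM2j.
Qed.

End convex_integrals.

(** * Image of a finite measure *)

Section finite_pushforward.
Context d1 d2 (T1 : measurableType d1) (T2 : measurableType d2) (R : realType).
Variables (mu : {finite_measure set T1 -> \bar R}) (phi : T1 -> T2).
Hypothesis mphi : measurable_fun setT phi.

Definition image_mass (A : set T2) : \bar R := mu (phi @^-1` A).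

Let image_mass0 : image_mass set0 = 0%E.
Proof. by rewrite /image_mass preimage_set0 measure0. Qed.

Let image_mass_ge0 A : (0 <= image_mass A)%E.
Proof. exact: measure_ge0. Qed.

Let image_mass_sigma_additive : semi_sigma_additive image_mass.
Proof. exact: (@measure_semi_sigma_additive _ _ _ (pushforward mu phi)). Qed.

HB.instance Definition _ := isMeasure.Build _ T2 R image_mass
  image_mass0 image_mass_ge0 image_mass_sigma_additive.

Let image_mass_fin : fin_num_fun image_mass.
Proof.
move=> A mA; apply: fin_num_measure.
by rewrite -[X in measurable X]setTI; exact: mphi.
Qed.

HB.instance Definition _ := Measure_isFinite.Build _ T2 R image_mass image_mass_fin.

Definition finite_pushforward : {finite_measure set T2 -> \bar R} := image_mass.

Lemma integral_finite_pushforward (u : T2 -> \bar R) : measurable_fun setT u ->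
  (\int[finite_pushforward]_y u y = \int[mu]_x u (phi x))%E.
Proof.
move=> mu_.
have ge0 (v : T2 -> \bar R) : measurable_fun setT v -> (forall y, 0 <= v y)%E ->
    (\int[finite_pushforward]_y v y = \int[mu]_x v (phi x))%E.
  move=> mv v0.
  have := ge0_integral_pushforward mphi mu measurableT mv (fun y _ => v0 y).
  by rewrite preimage_setT => <-; exact: eq_measure_integral.
rewrite integralE [RHS]integralE; congr (_ - _)%E.
  rewrite (ge0 _ (measurable_funepos mu_)); last by move=> y; exact: funepos_ge0.
  by apply: eq_integral => y _; rewrite !funeposE.
rewrite (ge0 _ (measurable_funeneg mu_)); last by move=> y; exact: funeneg_ge0.
by apply: eq_integral => y _; rewrite !funenegE.
Qed.

End finite_pushforward.

(** * Maps represented by a measure *)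

Section represented_map.
Context {R : realType} {n : nat}.
Notation V := 'cV[R]_n.
Variables (e : V) (theta : V -> 'M[R]_n).
Hypothesis thetaP : forall x : V, x != 0 ->
  SO (theta x) /\ theta x *m e = (enorm x)^-1 *: x.
Variables (Psi : Conv0 R n -> Conv0 R n)
  (mu : {finite_measure set (borelRn R n) -> \bar R}).
Hypotheses (inv : SO_stab_invariant e mu) (muc : compactly_supported mu)
  (rep : represents theta Psi mu).
Notation K := (measure_support mu).
Implicit Types (f g : Conv0 R n).

Let mK : measurable (K : set (borelRn R n)).
Proof. by apply: closed_borel; exact: measure_support_closed. Qed.

Let muK := measure_support_null mu.

Lemma mulmx_measurable (A : 'M[R]_n) :
  measurable_fun setT (fun y : borelRn R n => (A *m (y : V)) : borelRn R n).
Proof.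
apply: (@measurability _ _ (borelRn R n) (borelRn R n) setT _ (@open V)) => //.
move=> _ [U oU <-]; rewrite setTI; apply: open_borel.
by apply: open_comp => // x _; exact: mulmx_continuous.
Qed.

Lemma integral_stabilizer (eta : 'M[R]_n) (u : V -> \bar R) : SO_stab e eta ->
  measurable_fun setT (u : borelRn R n -> \bar R) ->
  (\int[mu]_y u (eta *m (y : V)) = \int[mu]_y u y)%E.
Proof.
move=> seta mu_; have meta := mulmx_measurable eta.
rewrite -(integral_finite_pushforward mu meta mu_).
by apply: eq_measure_integral => A mA _; exact: inv.
Qed.

Lemma rotated_measurable f (s : R) (th : 'M[R]_n) :
  measurable_fun setT (fun y : borelRn R n => f (s *: (th *m (y : V)))).
Proof.
under eq_fun do rewrite scalemxAl.
by apply: is_Conv0_mulmx_measurable; exact: Conv0P.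
Qed.

Lemma rotated_bounded_below f (s : R) (th : 'M[R]_n) :
  bounded_below_on (K : set (borelRn R n))
    (fun y : borelRn R n => f (s *: (th *m (y : V)))).
Proof.
have [m fm] := is_Conv0_bounded_below_on (s *: th) muc (Conv0P f).
by exists m => y /fm; rewrite -scalemxAl.
Qed.

(** Two rotations with the same pole differ by an element of the stabilizer. *)
Lemma integral_same_pole f (s : R) (th1 th2 : 'M[R]_n) : SO th1 -> SO th2 ->
  th1 *m e = th2 *m e ->
  (\int[mu]_y f (s *: (th1 *m (y : V))) = \int[mu]_y f (s *: (th2 *m (y : V))))%E.
Proof.
move=> s1 s2 e12; pose eta := th1^T *m th2.
have seta : SO_stab e eta.
  split; first exact: SO_mulmx (SO_trmx s1) s2.
  by rewrite -mulmxA -e12 mulmxA SO_trmxV// mul1mx.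
have th2E : th2 = th1 *m eta.
  by rewrite mulmxA; case: s1 => -> _; rewrite mul1mx.
rewrite -(integral_stabilizer seta (rotated_measurable f s th1)).
by apply: eq_integral => y _; rewrite th2E -mulmxA.
Qed.

Lemma represents_integral f x : Psi f x =
  (\int[mu]_y f (enorm x *: (theta x *m (y : V))))%E.
Proof.
have [repx e1 e2] := rep f.
have [->|/repx//] := eqVneq x 0.
rewrite e1 e2 enorm0 (eq_integral (cst (f 0))); last by move=> y _; rewrite scale0r.
by rewrite integral_cst.
Qed.

Lemma represents_additive : Conv0_additive Psi.
Proof.
move=> g h; apply: Conv0_eq => x /=; rewrite !represents_integral/=.
rewrite (integralD_bounded_below mK muK)//; first exact: rotated_measurable.
- exact: rotated_measurable.
- exact: rotated_bounded_below.
- exact: rotated_bounded_below.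
Qed.

Lemma represents_monotone : Conv0_monotone Psi.
Proof.
move=> f g fg x; rewrite !represents_integral.
apply: (le_integral_bounded_below mK muK) => //.
- exact: rotated_measurable.
- exact: rotated_measurable.
- exact: rotated_bounded_below.
Qed.

Lemma represents_radial : radially_equivariant Psi.
Proof.
move=> t x f t0; rewrite !represents_integral/= enormZ ?ltW//.
under [RHS]eq_integral do rewrite scalerA.
have [->|x0] := eqVneq x 0.
  by apply: eq_integral => y _; rewrite enorm0 mulr0 !scale0r.
have tx0 : t *: x != 0 by rewrite scaler_eq0 negb_or gt_eqF.
have [s1 h1] := thetaP tx0; have [s2 h2] := thetaP x0.
apply: integral_same_pole => //.
rewrite h1 h2 enormZ ?ltW// scalerA; congr (_ *: _).
by field; rewrite !gt_eqF// enorm_gt0.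
Qed.

Lemma represents_SO : SO_equivariant Psi.
Proof.
move=> eta f so; apply: Conv0_eq => x /=; rewrite !represents_integral/= SO_invmx//.
have st := SO_trmx so.
rewrite enorm_SO//; have [->|x0] := eqVneq x 0.
  by apply: eq_integral => y _; rewrite enorm0 !scale0r mulmx0.
have hx0 : eta^T *m x != 0.
  apply/eqP => h0; have := enorm_gt0 x0; rewrite -(enorm_SO x st) h0 enorm0 ltxx//.
have [s1 h1] := thetaP x0; have [s2 h2] := thetaP hx0.
under eq_integral do rewrite -scalemxAr mulmxA.
apply: integral_same_pole => //; first exact: SO_mulmx.
by rewrite -mulmxA h1 h2 enorm_SO// scalemxAr.
Qed.

Lemma represents_epi_continuous (fs : nat -> Conv0 R n) f :
  epi_cvg fs f -> epi_cvg (fun j => Psi (fs j)) (Psi f).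
Proof.
move=> fsf.
have fsC j : is_Conv0 (fs j) by exact: Conv0P.
have fC : is_Conv0 f by exact: Conv0P.
have muTE : mu setT = (fine (mu setT))%:E by rewrite fineK// fin_num_measure.
apply: epi_cvg_criterion => //; [by move=> j; exact: Conv0P|exact: Conv0P| | |].
- have [d [M [d0 fM]]] := epi_cvg_bounded_near0 fsf fsC fC.
  have [r r0 Kr] := compact_norm_le muc.
  pose c := n%:R * (n%:R * 1 * r) + 1.
  have c0 : 0 < c by rewrite ltr_wpDl// !mulr_ge0.
  exists (d / c), (M * fine (mu setT)); split; first by rewrite divr_gt0.
  apply: filterS fM => j fM x xd; rewrite represents_integral.
  apply: (@le_trans _ _ (\int[mu]_(y in setT) M%:E)%E); last first.
    by rewrite integral_cst// [X in (_ * X)%E]muTE EFinM.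
  apply: (le_integral_bounded_below mK muK).
  + exact: rotated_measurable.
  + exact: measurable_cst.
  + exact: rotated_bounded_below.
  + move=> y Ky; apply: fM; have [->|x0] := eqVneq x 0.
      by rewrite enorm0 scale0r normr0 ltW.
    have [s1 _] := thetaP x0.
    rewrite normrZ ger0_norm ?enorm_ge0//.
    have h1 : `|theta x *m y| <= n%:R * 1 * r.
      apply: le_trans (@mulmx_norm_le _ _ (theta x) 1 y ler01 _) _.
        by move=> i k; exact: SO_coord_le1.
      by rewrite ler_wpM2l ?Kr// mulr_ge0.
    apply: le_trans (ler_pM (enorm_ge0 x) (normr_ge0 _) (enorm_le x) h1) _.
    rewrite mulrAC; apply: (@le_trans _ _ (c * `|x|)).
      by rewrite ler_wpM2r// lerDl.
    by rewrite mulrC -ler_pdivlMr.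
- move=> x a; rewrite represents_integral.
  under eq_integral do rewrite scalemxAl.
  move=> /(epi_integral_lower muc fsf fsC fC); apply: filterS => j.
  rewrite represents_integral; under eq_integral do rewrite -scalemxAl.
  exact: ltW.
- have [M fM] := epi_integral_upper muc fsf fsC fC.
  exists M => x r t eps; rewrite represents_integral.
  under eq_integral do rewrite scalemxAl.
  move=> /fM H t01 eps0; apply: filterS (H t eps t01 eps0) => j.
  have /andP[t0 _] := t01.
  rewrite represents_radial// represents_integral/=.
  by under eq_integral do rewrite -scalemxAl.
Qed.

Lemma represents_continuous : continuous Psi.
Proof.
apply/continuousP => U oU; rewrite epi_openE => fs f Uf fsf.
by have := oU (fun j => Psi (fs j)) (Psi f) Uf (represents_epi_continuous fsf).
Qed.

Lemma first_moment_linear (l : {linear V -> R^o}) (A : 'M[R]_n) :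
  (\int[mu]_y (l (A *m (y : V)) : R)%:E = (l (A *m first_moment mu) : R)%:E)%E.
Proof.
have lE (x : V) : (l (A *m x) : R) = \sum_(i < n) x i 0 * l (A *m delta_mx i 0).
  rewrite {1}[x]matrix_sum_delta mulmx_sumr linear_sum.
  by apply: eq_bigr => i _; rewrite big_ord1 -scalemxAr linearZ.
have dco i : dc (fun x : V => x i 0).
  apply: cconvex_dc; split; first exact: coord_continuous.
  by move=> x y t _; rewrite !mxE.
have int_co i : mu.-integrable setT (fun y : borelRn R n => ((y : V) i 0)%:E).
  apply/integrableP; split; first exact: continuous_borel (dc_continuous (dco i)).
  have := dc_integral_fin muc muK (dc_max (dco i) (dcN (dco i))).
  rewrite (eq_integral (fun y : borelRn R n => `|((y : V) i 0)%:E|%E)).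
    by rewrite fin_numElt => /andP[].
  by move=> y _; rewrite /= -maxrN.
have intc_co i : mu.-integrable setT (fun y : borelRn R n =>
    ((l (A *m delta_mx i 0) : R)%:E * ((y : V) i 0)%:E)%E).
  exact: integrableZl.
rewrite (eq_integral (fun y : borelRn R n =>
    (\sum_(i < n) (l (A *m delta_mx i 0) : R)%:E * ((y : V) i 0)%:E)%E)); last first.
  by move=> y _; rewrite lE -sumEFin; apply: eq_bigr => i _; rewrite mulrC EFinM.
rewrite integral_sum// lE -sumEFin; apply: eq_bigr => i _.
rewrite integralZl// mxE mulrC EFinM /Rintegral fineK//.
by apply: (integrable_fin_num measurableT (int_co i)).
Qed.

Lemma represents_add_linear f (l : {linear V -> R^o}) x :
  Psi (Conv0_add_linear f l) x =
  (Psi f x + (l (enorm x *: (theta x *m first_moment mu)) : R)%:E)%E.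
Proof.
rewrite !represents_integral/= scalemxAl -first_moment_linear.
rewrite -(integralD_bounded_below mK muK).
- by apply: eq_integral => y _; rewrite scalemxAl.
- exact: rotated_measurable.
- under eq_fun do rewrite -scalemxAl.
  exact: (rotated_measurable (MkConv0 (is_Conv0_linear l))).
- exact: rotated_bounded_below.
- have := rotated_bounded_below (MkConv0 (is_Conv0_linear l)) (enorm x) (theta x).
  by move=> [m lm]; exists m => y /lm; rewrite scalemxAl.
Qed.

Definition coordinate_form (i : 'I_n) (x : V) : R^o := x i 0.

Fact coordinate_form_is_linear i : linear (coordinate_form i).
Proof. by move=> a x y; rewrite /coordinate_form !mxE. Qed.

HB.instance Definition _ i := GRing.isLinear.Build R V R^o *:%R (coordinate_form i)
  (coordinate_form_is_linear i).

Lemma represents_translation_invariant : enorm e = 1 ->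
  dually_translation_invariant Psi <-> first_moment mu = 0.
Proof.
move=> e1; have e0 : e != 0.
  by apply/eqP => e0; move: e1; rewrite e0 enorm0 => /eqP; rewrite eq_sym oner_eq0.
split=> [inv0|m0 f l]; last first.
  apply: Conv0_eq => x; rewrite represents_add_linear m0 mulmx0 scaler0 linear0.
  by rewrite adde0.
have [se _] := thetaP e0.
suff Am0 : theta e *m first_moment mu = 0.
  by rewrite -[LHS]mul1mx -(SO_trmxV se) -mulmxA Am0 mulmx0.
apply/matrixP => i j; rewrite ord1 [RHS]mxE.
pose z : Conv0 R n := MkConv0 (cconvex_is_Conv0 (cconvex_cst 0)).
have := represents_add_linear z (coordinate_form i) e.
rewrite inv0 e1 scale1r (_ : Psi z e = 0%E); last first.
  rewrite represents_integral (eq_integral (cst 0%E)) ?integral0//.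
by rewrite add0e => -[].
Qed.

End represented_map.

(** * Representation of equivariant maps *)

Section equivariant_map.
Context {R : realType} {n : nat}.
Notation V := 'cV[R]_n.
Implicit Types (f g h : Conv0 R n).

(** Epi-convergence bounds the lower limit of the values at a fixed point, so the
    functions with value larger than [a] at [x] form an open set. *)
Lemma continuous_lower_bound (Psi : Conv0 R n -> Conv0 R n)
    (fs : nat -> Conv0 R n) f x (a : R) : continuous Psi -> epi_cvg fs f ->
  (a%:E < Psi f x)%E -> \forall j \near \oo, (a%:E < Psi (fs j) x)%E.
Proof.
move=> /continuousP Psic fsf ax; pose U := [set g : Conv0 R n | (a%:E < g x)%E].
have oU : open U.
  rewrite epi_openE => gs g Ug gsg; exact: (epi_cvg_liminf gsg (cvg_cst x) Ug).
by have := Psic U oU; rewrite epi_openE => /(_ fs f ax fsf).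
Qed.

Definition ball_indicator (r : R) (x : V) : \bar R :=
  if `|x| <= r then 0%E else +oo%E.

Lemma ball_indicator_is_Conv0 (r : R) : 0 < r -> is_Conv0 (ball_indicator r).
Proof.
move=> r0; split; last first.
  have n0 : nbhs (0 : V) [set x | `|0 - x| <= r].
    exact: (@cvgr_dist_le _ _ _ (nbhs (0 : V)) (nbhs_filter (0 : V)) id (0 : V) cvg_id _ r0).
  by apply: filterS n0 => x /=; rewrite sub0r normrN /ball_indicator => ->.
split.
- by move=> x; rewrite /ball_indicator; case: ifP.
- by exists 0; rewrite /ball_indicator normr0 ltW.
- move=> x a; rewrite {1}/ball_indicator; case: ifP => [xr a0|/negbT].
    exists setT; first exact: filterT.
    by move=> y _; rewrite /ball_indicator; case: ifP => _ //; rewrite ltry.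
  rewrite -ltNge => rx _; exists [set y | r < `|y|].
    apply: open_nbhs_nbhs; split => //.
    by apply: (open_comp _ (@open_gt _ r)) => u _; exact: norm_continuous.
  by move=> y /= ry; rewrite /ball_indicator leNgt ry/= ltry.
- move=> x y t /andP[t0 t1]; rewrite /ball_indicator.
  have t1' : 0 <= 1 - t by rewrite subr_ge0.
  have [t00|t0'] := eqVneq t 0.
    rewrite t00 scale0r add0r subr0 scale1r mul0e add0e mul1e.
    by case: ifP.
  have [t10|t1''] := eqVneq t 1.
    rewrite t10 subrr scale0r addr0 scale1r mul0e adde0 mul1e.
    by case: ifP.
  have tp : (0 < t%:E)%E by rewrite lte_fin lt_neqAle eq_sym t0'.
  have tp' : (0 < (1 - t)%:E)%E by rewrite lte_fin subr_gt0 lt_neqAle t1''.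
  have [xr|_] := boolP (`|x| <= r); have [yr|_] := boolP (`|y| <= r).
  + suff -> : `|t *: x + (1 - t) *: y| <= r by rewrite !mule0 adde0.
    apply: le_trans (ler_normD _ _) _; rewrite !normrZ !ger0_norm//.
    by have := ler_wpM2l t0 xr; have := ler_wpM2l t1' yr; lra.
  + by rewrite mule0 add0e gt0_muley// leey.
  + by rewrite mule0 adde0 gt0_muley// leey.
  + by rewrite !gt0_muley// leey.
Qed.

Definition Conv0_ball (r : R) (r0 : 0 < r) : Conv0 R n :=
  MkConv0 (ball_indicator_is_Conv0 r0).

Definition Conv0_of (g : V -> R) (cg : cconvex g) : Conv0 R n :=
  MkConv0 (cconvex_is_Conv0 cg).

Definition Conv0_cst (c : R) : Conv0 R n := Conv0_of (cconvex_cst c).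

Variables (e : V) (Psi : Conv0 R n -> Conv0 R n).
Hypotheses (e_unit : enorm e = 1) (Psi_cont : continuous Psi)
  (PsiD : Conv0_additive Psi) (Psi_mono : Conv0_monotone Psi)
  (PsiZ : radially_equivariant Psi) (Psi_SO : SO_equivariant Psi).

Notation F f := (Psi f e).

Lemma pole_neq0 : e != 0.
Proof.
by apply/eqP => e0; move: e_unit; rewrite e0 enorm0 => /eqP; rewrite eq_sym oner_eq0.
Qed.

Lemma pole_value_NyN f : F f != -oo%E.
Proof. by have [[h _ _ _] _] := Conv0P (Psi f). Qed.

Lemma pole_valueD f g : F (Conv0_add f g) = (F f + F g)%E.
Proof. by rewrite PsiD. Qed.

Lemma dilated_pole_value_fin f : exists2 t : R, 0 < t & F (Conv0_dilate t f) \is a fin_num.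
Proof.
have [_ /nbhs_normP[d /= d0 dP]] := Conv0P (Psi f).
have e0 : 0 < `|e| by rewrite normr_gt0 pole_neq0.
have t0 : 0 < d / 2 / `|e| by rewrite !divr_gt0.
exists (d / 2 / `|e|) => //; rewrite -PsiZ//; apply: dP.
rewrite /= sub0r normrN normrZ gtr0_norm// divfK ?gt_eqF//.
by rewrite ltr_pdivrMr// ltr_pMr// ltr1n.
Qed.

(** The indicator of a ball is idempotent for the addition, so its image takes
    only the values 0 and +oo; it is finite at small multiples of [e], that is
    at [e] for large balls. *)
Lemma ball_pole_value0 : exists r (r0 : 0 < r), F (Conv0_ball r0) = 0%E.
Proof.
have [t t0 Ft] := dilated_pole_value_fin (Conv0_ball ltr01).
have r0 : 0 < t^-1 by rewrite invr_gt0.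
exists t^-1, r0.
have BE : Conv0_dilate t (Conv0_ball ltr01) = Conv0_ball r0.
  apply: Conv0_eq => x; rewrite /= /ball_indicator normrZ gtr0_norm//.
  by rewrite -ler_pdivlMl// mulr1.
have BB : Conv0_add (Conv0_ball r0) (Conv0_ball r0) = Conv0_ball r0.
  by apply: Conv0_eq => x; rewrite /= /ball_indicator; case: ifP; rewrite ?adde0 ?addye.
rewrite BE in Ft; have := pole_valueD (Conv0_ball r0) (Conv0_ball r0).
rewrite BB; move: Ft; case: (F _) => [a| |] //= _ [aa].
by congr EFin; lra.
Qed.

Section with_ball.
Variables (r : R) (r0 : 0 < r).
Hypothesis F_ball : F (Conv0_ball r0) = 0%E.
Notation B := [set x : V | `|x| <= r].

(** Adding the indicator of the ball to [g] does not change the value at [e] of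
    its image, and [f <= g + I] everywhere. *)
Lemma pole_value_le f g : (forall x, B x -> (f x <= g x)%E) -> (F f <= F g)%E.
Proof.
move=> fg; rewrite -[leRHS]adde0 -F_ball -pole_valueD; apply: Psi_mono => x /=.
rewrite /ball_indicator; case: ifP => [/fg fgx|_]; first by rewrite adde0.
by have [[+ _ _ _] _] := Conv0P g => /(_ x) gx; rewrite addey ?leey.
Qed.

Lemma pole_value_cst_fin (c : R) : F (Conv0_cst c) \is a fin_num.
Proof.
have [t t0] := dilated_pole_value_fin (Conv0_cst c).
by rewrite (_ : Conv0_dilate _ _ = Conv0_cst c)//; exact: Conv0_eq.
Qed.

Let Bc : compact B := @cV_closed_ball_compact R n r.

Lemma pole_value_cconvex_fin (g : V -> R) (cg : cconvex g) :
  F (Conv0_of cg) \is a fin_num.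
Proof.
have [M gM] := continuous_bounded_on Bc (proj1 cg).
have gM' x : B x -> - M%:R <= g x <= M%:R by move=> /gM; rewrite ler_norml.
rewrite fin_numElt; apply/andP; split; first by rewrite ltNye pole_value_NyN.
apply: (@le_lt_trans _ _ (F (Conv0_cst M%:R))); last by rewrite ltey_eq pole_value_cst_fin.
by apply: pole_value_le => x /gM' /andP[_]; rewrite lee_fin.
Qed.

Definition pole_functional (g : V -> R) : R :=
  if pselect (cconvex g) is left cg then fine (F (Conv0_of cg)) else 0.

Lemma pole_functionalE (g : V -> R) (cg : cconvex g) :
  F (Conv0_of cg) = (pole_functional g)%:E.
Proof.
rewrite /pole_functional; case: pselect => // cg'.
by rewrite (Prop_irrelevance cg' cg) fineK// pole_value_cconvex_fin.
Qed.

Lemma pole_functional_measure : exists mu : {finite_measure set (borelRn R n) -> \bar R},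
  mu (~` B) = 0%E /\
  forall (g : V -> R) (cg : cconvex g), F (Conv0_of cg) = (\int[mu]_y (g y)%:E)%E.
Proof.
have [||mu [muB muE]] := @convex_riesz_representation R n B pole_functional Bc.
- move=> g h cg ch; have cgh := cconvexD cg ch.
  apply: EFin_inj; rewrite EFinD -!pole_functionalE -pole_valueD.
  by congr (Psi _ _); exact: Conv0_eq.
- move=> g h cg ch gh; rewrite -lee_fin -!pole_functionalE.
  by apply: pole_value_le => x /gh; rewrite lee_fin.
by exists mu; split => // g cg; rewrite pole_functionalE muE.
Qed.

Variable mu : {finite_measure set (borelRn R n) -> \bar R}.
Hypotheses (muB : mu (~` B) = 0%E) (muE : forall (g : V -> R) (cg : cconvex g),
  F (Conv0_of cg) = (\int[mu]_y (g y)%:E)%E).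

Let mB : measurable (B : set (borelRn R n)).
Proof. by apply: closed_borel; exact: cV_closed_ball_closed. Qed.

Let Conv0_borel f : measurable_fun setT (f : borelRn R n -> \bar R).
Proof. by have [[_ _ lf _] _] := Conv0P f; exact: lower_semicontinuous_borel. Qed.

Let Conv0_bounded_below f : bounded_below_on (B : set (borelRn R n)) f.
Proof.
have [m fm] := is_Conv0_bounded_below_on 1%:M Bc (Conv0P f).
by exists m => y /fm; rewrite mul1mx.
Qed.

(** The two sides agree on the inf-convolutions of [f], which increase to [f];
    each side at [f] is the limit of these common values, by monotonicity and by
    continuity of [Psi] on the left, Fatou's lemma on the right. *)
Lemma pole_value_integral f : F f = (\int[mu]_y f y)%E.
Proof.
have [g [cg gS gf fg]] := is_Conv0_approximation (Conv0P f).
pose G k := Conv0_of (cg k).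
have GE k : F (G k) = (\int[mu]_y (G k : V -> \bar R) y)%E by exact: muE.
apply/eqP; rewrite eq_le; apply/andP; split.
  apply: le_ereal_fin_lt => a aF.
  have Gf : epi_cvg G f.
    by apply: epi_cvg_nondecreasing => // k; exact: (proj1 (cg k)).
  have [N _ /(_ N (leqnn N)) aN] := continuous_lower_bound Psi_cont Gf aF.
  apply: le_trans (ltW aN) _; rewrite GE.
  apply: (le_integral_bounded_below mB muB).
  - exact: Conv0_borel.
  - exact: Conv0_borel.
  - exact: Conv0_bounded_below.
  - by move=> y _; exact: gf.
have gle k l x : (k <= l)%N -> g k x <= g l x.
  by move=> kl; apply: (homo_leq (f := fun i => g i x) le_refl le_trans).
have [m gm] := Conv0_bounded_below (G 0%N).
apply: (@le_trans _ _ (limn_einf (fun k => \int[mu]_y (G k : V -> \bar R) y)%E)).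
  apply: (fatou_bounded_below mB muB (M := m)).
  - exact: Conv0_borel.
  - by move=> k; exact: Conv0_borel.
  - exact: Conv0_bounded_below.
  - by apply: nearW => k y /gm /le_trans; apply; rewrite lee_fin gle.
  - move=> y a _ /fg[k ak]; exists k => // j /= kj.
    by rewrite lee_fin (le_trans (ltW ak))// gle.
apply: le_ereal_fin_lt => a /(limn_einf_gt (lexx _))[N _ /(_ N (leqnn N)) aN].
apply: le_trans (ltW aN) _; rewrite -GE; apply: Psi_mono => x; exact: gf.
Qed.

Lemma equivariant_value f (s : R) (th : 'M[R]_n) : 0 < s -> SO th ->
  Psi f (s *: (th *m e)) = (\int[mu]_y f (s *: (th *m (y : V))))%E.
Proof.
move=> s0 so; have st := SO_trmx so.
rewrite PsiZ// -[th in LHS]trmxK -(SO_invmx st).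
have -> : Psi (Conv0_dilate s f) (invmx th^T *m e) =
    F (Conv0_act th^T (Conv0_dilate s f)) by rewrite Psi_SO.
rewrite pole_value_integral; apply: eq_integral => y _ /=.
by rewrite SO_invmx// trmxK.
Qed.

(** The image of [mu] under an element of the stabilizer gives the same integrals
    to finite convex functions. The ball is enlarged because the sup-norm ball
    [B] need not be invariant. *)
Lemma pole_measure_invariant : SO_stab_invariant e mu.
Proof.
move=> eta [so eta_e] A mA.
have meta := mulmx_measurable eta.
pose nu := finite_pushforward mu meta.
pose r' := n%:R * 1 * r + r.
pose B' : set V := [set x | `|x| <= r'].
have muB' : mu (~` B') = 0%E.
  apply/eqP; rewrite eq_le measure_ge0 andbT -[leRHS]muB.
  apply: le_measure; rewrite ?inE.
  - by apply: measurableC; apply: closed_borel; exact: cV_closed_ball_closed.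
  - by apply: measurableC.
  - move=> x /= xB' xB; apply: xB'; rewrite /B'/=; apply: le_trans xB _.
    by rewrite /r' lerDr !mulr_ge0// ltW.
have nuB' : nu (~` B') = 0%E.
  have -> : nu (~` B') = mu ((fun y : borelRn R n => eta *m (y : V)) @^-1` (~` B')).
    by [].
  apply/eqP; rewrite eq_le measure_ge0 andbT -[leRHS]muB.
  apply: le_measure; rewrite ?inE.
  - rewrite -[X in measurable X]setTI; apply: (meta measurableT).
    by apply: measurableC; apply: closed_borel; exact: cV_closed_ball_closed.
  - by apply: measurableC.
  - move=> x /= xB' xB; apply: xB'; rewrite /B'/=.
    apply: le_trans (@mulmx_norm_le _ _ eta 1 x ler01 _) _.
      by move=> i k; exact: SO_coord_le1.
    apply: (@le_trans _ _ (n%:R * 1 * r)); first by rewrite ler_wpM2l// mulr_ge0.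
    by rewrite /r' lerDl ltW.
have B'c : compact B' := @cV_closed_ball_compact R n r'.
apply: (cconvex_measure_unique B'c nuB' muB') => // g cg.
transitivity (\int[mu]_y (g (eta *m (y : V)))%:E)%E.
  by apply: (integral_finite_pushforward mu meta); exact: continuous_borel (proj1 cg).
have := equivariant_value (Conv0_of cg) ltr01 so.
rewrite eta_e scale1r (muE cg) => ->.
by apply: eq_integral => y _; rewrite /= scale1r.
Qed.

Lemma pole_value_cst (c : R) : F (Conv0_cst c) = (c * fine (mu setT))%:E.
Proof.
by rewrite [LHS]muE integral_cst// EFinM fineK// fin_num_measure.
Qed.

(** Both sides are compared with [Psi f (t *: e)], whose distance to each of them
    is of the order of [t]. *)
Lemma equivariant_value0 f : Psi f 0 = (f 0%R * mu setT)%E.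
Proof.
have [d [C [d0 C0 fl fu]]] := is_Conv0_lipschitz_at0 (Conv0P f).
have [d' [C' [d'0 C'0 Pl Pu]]] := is_Conv0_lipschitz_at0 (Conv0P (Psi f)).
have T0 : 0 <= fine (mu setT) by rewrite fine_ge0.
have e0 : 0 < `|e| by rewrite normr_gt0 pole_neq0.
rewrite -(fineK (is_Conv0_fin0 (Conv0P f))) -(fineK (is_Conv0_fin0 (Conv0P (Psi f)))).
rewrite -(fineK (fin_num_measure mu setT measurableT)) -EFinM.
set c := fine (f 0) in fl fu *; set p := fine (Psi f 0) in Pl Pu *.
set T := fine (mu setT) in T0 *.
pose delta := Num.min (d / r) (d' / `|e|).
have delta0 : 0 < delta by rewrite lt_min !divr_gt0.
have near0 t : 0 < t -> t <= delta ->
    `|p - c * T| <= t * (C * r * T + C' * `|e|).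
  move=> t0; rewrite le_min !ler_pdivlMr// => /andP[td td'].
  have te : `|t *: e| = t * `|e| by rewrite normrZ gtr0_norm.
  have := Pl (t *: e); have := Pu (t *: e); rewrite te => /(_ td').
  have yt y : B y -> `|t *: y| <= t * r by move=> By; rewrite normrZ gtr0_norm// ler_pM2l.
  have lo : (((c - C * (t * r)) * T)%:E <= Psi f (t *: e)%R)%E.
    rewrite -pole_value_cst PsiZ//; apply: pole_value_le => y /yt ty /=.
    by apply: le_trans (fl _); rewrite lee_fin lerD2l lerN2 ler_wpM2l.
  have up : (Psi f (t *: e)%R <= ((c + C * (t * r)) * T)%:E)%E.
    rewrite -pole_value_cst PsiZ//; apply: pole_value_le => y /yt ty /=.
    apply: le_trans (fu _ (le_trans ty td)) _.
    by rewrite lee_fin lerD2l ler_wpM2l.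
  move: lo up; case: (Psi f (t *: e)) => [q| |] //; rewrite !lee_fin => lo up qu ql.
  by rewrite ler_norml; apply/andP; split; lra.
congr EFin; apply/eqP; rewrite -subr_eq0 -normr_le0.
apply: (@le_of_le_harmonic _ _ _ (delta * (C * r * T + C' * `|e|))) => m m0.
rewrite add0r mulrAC; apply: near0; first by rewrite divr_gt0// ltr0n.
by rewrite ler_pdivrMr ?ltr0n// ler_peMr ?(ltW delta0)// ler1n.
Qed.

End with_ball.

End equivariant_map.

Section equivariant_representation.
Context {R : realType} {n : nat}.
Notation V := 'cV[R]_n.
Variables (e : V) (theta : V -> 'M[R]_n) (Psi : Conv0 R n -> Conv0 R n).
Hypotheses (e_unit : enorm e = 1)
  (thetaP : forall x : V, x != 0 ->
    SO (theta x) /\ theta x *m e = (enorm x)^-1 *: x).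

Lemma equivariant_represented : continuous Psi -> Conv0_additive Psi ->
  Conv0_monotone Psi -> radially_equivariant Psi -> SO_equivariant Psi ->
  exists mu : {finite_measure set (borelRn R n) -> \bar R},
    [/\ SO_stab_invariant e mu, compactly_supported mu & represents theta Psi mu].
Proof.
move=> Pc PD Pm PZ PSO.
have [r [r0 Fr]] := ball_pole_value0 e_unit PD PZ.
have [mu [muB muE]] := pole_functional_measure e_unit PD Pm PZ Fr.
exists mu; split.
- exact: (pole_measure_invariant Pc Pm PZ PSO r0 muB muE).
- apply: (@subclosed_compact _ (measure_support mu) [set x | `|x| <= r]).
  + exact: measure_support_closed.
  + exact: cV_closed_ball_compact.
  + by apply: measure_support_sub => //; exact: cV_closed_ball_closed.
- move=> f; have limE := is_Conv0_limf_einf0 (pole_neq0 e_unit) (Conv0P (Psi f)).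
  split => [x x0||].
  + have [so xe] := thetaP x0.
    rewrite -(equivariant_value Pc Pm PZ PSO muB muE f (enorm_gt0 x0) so).
    by rewrite xe scalerA divff ?scale1r// gt_eqF// enorm_gt0.
  + by rewrite limE.
  + rewrite limE.
    exact: (equivariant_value0 e_unit PD Pm PZ Fr muE f).
Qed.

Lemma represents_unique (mu nu : {finite_measure set (borelRn R n) -> \bar R}) :
  compactly_supported mu -> represents theta Psi mu ->
  compactly_supported nu -> represents theta Psi nu ->
  forall A : set (borelRn R n), measurable A -> mu A = nu A.
Proof.
move=> muc murep nuc nurep.
have [r1 _ K1] := compact_norm_le muc; have [r2 _ K2] := compact_norm_le nuc.
pose B : set V := [set x | `|x| <= Num.max r1 r2].
have Bc : compact B := @cV_closed_ball_compact R n _.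
have null (m : {finite_measure set (borelRn R n) -> \bar R}) :
    measure_support m `<=` B -> m (~` B) = 0%E.
  move=> mB; apply/eqP; rewrite eq_le measure_ge0 andbT.
  rewrite -[leRHS](measure_support_null m); apply: le_measure; rewrite ?inE.
  - by apply: measurableC; apply: closed_borel; exact: compact_closed Bc.
  - by apply: measurableC; apply: closed_borel; exact: measure_support_closed.
  - exact: subsetC.
have [se _] := thetaP (pole_neq0 e_unit).
have repE (m : {finite_measure set (borelRn R n) -> \bar R}) (g : V -> R)
    (cg : cconvex g) : represents theta Psi m ->
    (\int[m]_y (g y)%:E)%E = Psi (Conv0_of (cconvex_mulmx (theta e)^T cg)) e.
  move=> /(_ (Conv0_of (cconvex_mulmx (theta e)^T cg))) [/(_ e (pole_neq0 e_unit)) -> _ _].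
  apply: eq_integral => y _ /=.
  by rewrite e_unit scale1r mulmxA SO_trmxV// mul1mx.
apply: (cconvex_measure_unique Bc).
- by apply: null => x /K1 xr; rewrite /B/= le_max xr.
- by apply: null => x /K2 xr; rewrite /B/= le_max xr orbT.
- by move=> g cg; rewrite !(repE _ _ cg).
Qed.

End equivariant_representation.

(** * Characterization of the equivariant maps *)

Theorem theorem3 (R : realType) (n : nat) (n_ge2 : (2 <= n)%N)
    (e : 'cV[R]_n) (e_unit : enorm e = 1)
    (theta : 'cV[R]_n -> 'M[R]_n)
    (thetaP : forall x : 'cV[R]_n, x != 0 ->
       SO (theta x) /\ theta x *m e = (enorm x)^-1 *: x)
    (Psi : Conv0 R n -> Conv0 R n) :
  ([/\ continuous Psi, Conv0_additive Psi, Conv0_monotone Psi,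
       radially_equivariant Psi & SO_equivariant Psi] <->
   exists mu : {finite_measure set (borelRn R n) -> \bar R},
     [/\ SO_stab_invariant e mu, compactly_supported mu &
         represents theta Psi mu]) /\
  (forall mu nu : {finite_measure set (borelRn R n) -> \bar R},
     SO_stab_invariant e mu -> compactly_supported mu ->
     represents theta Psi mu ->
     SO_stab_invariant e nu -> compactly_supported nu ->
     represents theta Psi nu ->
     forall A : set (borelRn R n), measurable A -> mu A = nu A) /\
  (forall mu : {finite_measure set (borelRn R n) -> \bar R},
     SO_stab_invariant e mu -> compactly_supported mu ->
     represents theta Psi mu ->
     (dually_translation_invariant Psi <-> first_moment mu = 0)).
Proof.
split; [split|split].
- by case; exact: equivariant_represented.
- move=> [mu [inv muc rep]]; split.
  + exact: (@represents_continuous _ _ _ _ thetaP _ _ inv muc rep).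
  + exact: represents_additive muc rep.
  + exact: represents_monotone muc rep.
  + exact: (@represents_radial _ _ _ _ thetaP _ _ inv rep).
  + exact: (@represents_SO _ _ _ _ thetaP _ _ inv rep).
- by move=> mu nu _ muc murep _ nuc nurep; exact: (represents_unique e_unit thetaP).
- move=> mu _ muc rep; exact (represents_translation_invariant thetaP muc rep e_unit).
Qed.
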